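(* The theory consisting of $\mathsf{EA}^{\circ}$, the Converse Barcan Formula $\mathsf{CBF}$, and Epistemic Church's Thesis $\mathsf{ECT}$ is consistent with both the failure of $\mathsf{EA}$ and the failure of the Barcan Formula $\mathsf{BF}$: $$[\forall x\,\Box\,\varphi(x)]\Rightarrow[\Box\,\forall x\,\varphi(x)].$$
   Context: Quantified modal logic. Modal formulas are built from atomic formulas (including identities) and $\bot$ by $\wedge,\vee,\Rightarrow,\forall,\exists,\Box$; $\neg\varphi$ is $\varphi\Rightarrow\bot$. The Hilbert system $Q^{\circ}.\mathsf{K}$ has as axioms: all instances of classical propositional tautologies; $\Box(\varphi\Rightarrow\psi)\Rightarrow(\Box\varphi\Rightarrow\Box\psi)$; $(\forall x\,\varphi)\Leftrightarrow\varphi$ for $x$ not free in $\varphi$; $[\forall x(\varphi\Rightarrow\psi)]\Rightarrow[(\forall x\,\varphi)\Rightarrow(\forall x\,\psi)]$; $\forall x\forall y\,\varphi\Leftrightarrow\forall y\forall x\,\varphi$; the Universal Instantiation axiom $\forall y\,((\forall x\,\varphi(x))\Rightarrow\varphi(y))$; with $\exists x\,\varphi$ equivalent to $\neg\forall x\neg\varphi$ as usual. Its rules are modus ponens, universal generalization (from $\varphi$ infer $\forall x\,\varphi$) and necessitation (from $\varphi$ infer $\Box\varphi$). $Q.\mathsf{K}$ is the same except that Universal Instantiation is replaced by its free-variable variant $(\forall x\,\varphi(x))\Rightarrow\varphi(y)$. $Q^{\circ}.\mathsf{S4}$ and $Q.\mathsf{S4}$ add the schemas $\Box\varphi\Rightarrow\varphi$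 and $\Box\varphi\Rightarrow\Box\Box\varphi$. $Q^{\circ}_{eq}.\mathsf{S4}$ and $Q_{eq}.\mathsf{S4}$ further add, for all terms $s,t$, the axioms $t=t$ and $s=t\Rightarrow(\varphi(t)\Rightarrow\varphi(s))$. Arithmetic. The signature is $L_0=\{0,S,f_1,f_2,\ldots\}$, where $0$ is zero, $S$ is successor, and $f_1,f_2,\ldots$ enumerates function symbols for the primitive recursive functions. $\mathsf{PA}$ is Peano arithmetic in the signature $L_0$. $\mathsf{EA}^{\circ}$ is $Q^{\circ}_{eq}.\mathsf{S4}$ plus $\mathsf{PA}$, and $\mathsf{EA}$ is $Q_{eq}.\mathsf{S4}$ plus $\mathsf{PA}$, where in both cases induction axioms are included for all formulas in the extended modal language. Schemas. $\mathsf{CBF}$ is $\Box\,\forall x\,\varphi(x)\Rightarrow\forall x\,\Box\,\varphi(x)$. $\mathsf{ECT}$ is $$[\Box(\forall n\,\exists m\,\Box\varphi(n,m))]\Rightarrow[\exists e\,\Box\,\forall n\,\exists m\,\exists q\,(T(e,n,q)\wedge U(q,m)\wedge\Box\varphi(n,m))],$$ where the quantifiers range over natural numbers, $T(e,n,q)$ is Kleene's $T$-predicate (program $e$ on input $n$ halts and outputs a code $q$ for the halting computation) and $U(q,m)$ says that the computation $q$ has output value $m$. *)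

(* Defs.v *)
From Stdlib Require Export Arith Lia List Cantor.
From Stdlib Require Vector.
Import Vector.VectorNotations.

Arguments to_nat : simpl never.
Arguments of_nat : simpl never.

Inductive prim : nat -> Type :=
| pZero : prim 0
| pSucc : prim 1
| pProj {k} (i : Fin.t k) : prim k
| pComp {k m} (f : prim m) (gs : Vector.t (prim k) m) : prim k
| pRec {k} (f : prim k) (g : prim (S (S k))) : prim (S k).

Fixpoint eval {k} (f : prim k) : Vector.t nat k -> nat :=
  match f with
  | pZero => fun _ => 0
  | pSucc => fun v => S (Vector.hd v)
  | pProj i => fun v => Vector.nth v i
  | pComp f gs => fun v => eval f (Vector.map (fun g => eval g v) gs)
  | pRec f g => fun v =>
      nat_rect (fun _ => nat) (eval f (Vector.tl v))
        (fun m r => eval g (m :: r :: Vector.tl v)) (Vector.hd v)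
  end.

Local Notation x0 := (pProj Fin.F1).
Local Notation x1 := (pProj (Fin.FS Fin.F1)).
Local Notation x2 := (pProj (Fin.FS (Fin.FS Fin.F1))).
Local Notation x3 := (pProj (Fin.FS (Fin.FS (Fin.FS Fin.F1)))).

Definition ap1 {k} (f : prim 1) (a : prim k) : prim k := pComp f [a].
Definition ap2 {k} (f : prim 2) (a b : prim k) : prim k := pComp f [a; b].
Definition ap3 {k} (f : prim 3) (a b c : prim k) : prim k := pComp f [a; b; c].

Fixpoint pConst {k} (n : nat) : prim k :=
  match n with 0 => pComp pZero [] | S n => ap1 pSucc (pConst n) end.

Definition pPred : prim 1 := pRec pZero x0.
Definition pAdd : prim 2 := pRec x0 (ap1 pSucc x1).
Definition pSub : prim 2 := ap2 (pRec x0 (ap1 pPred x1)) x1 x0.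
Definition pIfz : prim 3 := pRec x0 x3.
Definition pEqb : prim 2 :=
  ap3 pIfz (ap2 pAdd (ap2 pSub x0 x1) (ap2 pSub x1 x0)) (pConst 1) (pConst 0).

(** Cantor pairing and its projections, as in [Stdlib.Arith.Cantor]. *)
Definition pTri : prim 1 := pRec pZero (ap2 pAdd (ap1 pSucc x0) x1).
Definition pPair : prim 2 := ap2 pAdd x1 (ap1 pTri (ap2 pAdd x1 x0)).
Definition pRoot : prim 1 :=
  pRec pZero (ap3 pIfz (ap2 pSub (ap1 pTri (ap1 pSucc x1)) (ap1 pSucc x0))
                (ap1 pSucc x1) x1).
Definition pSnd : prim 1 := ap2 pSub x0 (ap1 pTri (ap1 pRoot x0)).
Definition pFst : prim 1 := ap2 pSub (ap1 pRoot x0) (ap1 pSnd x0).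

Fixpoint pSwitch {k} (t : prim k) (l : list (prim k)) (d : prim k) : prim k :=
  match l with
  | nil => d
  | cons a l => ap3 pIfz t a (pSwitch (ap1 pPred t) l d)
  end.

(** Every program computes a unary partial function; several arguments are
    passed by Cantor pairing. *)
Inductive code : Type :=
| cZero | cSucc | cLeft | cRight
| cPair (f g : code)
| cComp (f g : code)
| cPrec (f g : code)
| cMu (f : code).

Notation "⟨ x , y ⟩" := (to_nat (x, y)).

Inductive computes : code -> nat -> nat -> Prop :=
| ev_zero n : computes cZero n 0
| ev_succ n : computes cSucc n (S n)
| ev_left a b : computes cLeft ⟨a, b⟩ a
| ev_right a b : computes cRight ⟨a, b⟩ b
| ev_pair f g n a b : computes f n a -> computes g n b ->
    computes (cPair f g) n ⟨a, b⟩
| ev_comp f g n a b : computes g n a -> computes f a b ->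
    computes (cComp f g) n b
| ev_prec0 f g a r : computes f a r -> computes (cPrec f g) ⟨a, 0⟩ r
| ev_precS f g a m r s : computes (cPrec f g) ⟨a, m⟩ r ->
    computes g ⟨a, ⟨m, r⟩⟩ s -> computes (cPrec f g) ⟨a, S m⟩ s
| ev_mu0 f a m : computes f ⟨a, m⟩ 0 -> computes (cMu f) ⟨a, m⟩ m
| ev_muS f a m k r : computes f ⟨a, m⟩ (S k) ->
    computes (cMu f) ⟨a, S m⟩ r -> computes (cMu f) ⟨a, m⟩ r.

(** A stack machine running programs.  A frame records what remains to be done
    with the value being computed. *)
Inductive frame : Type :=
| FPair1 (g : code) (n : nat)
| FPair2 (u : nat)
| FComp (f : code)
| FPrec (g : code) (a m : nat)
| FMu (f : code) (a m : nat).

Inductive config : Type :=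
| Eval (c : code) (n : nat) (s : list frame)
| Ret (v : nat) (s : list frame).

Definition step (x : config) : config :=
  match x with
  | Eval cZero n s => Ret 0 s
  | Eval cSucc n s => Ret (S n) s
  | Eval cLeft n s => Ret (fst (of_nat n)) s
  | Eval cRight n s => Ret (snd (of_nat n)) s
  | Eval (cPair f g) n s => Eval f n (cons (FPair1 g n) s)
  | Eval (cComp f g) n s => Eval g n (cons (FComp f) s)
  | Eval (cPrec f g) n s =>
      let (a, m) := of_nat n in
      match m with
      | 0 => Eval f a s
      | S m => Eval (cPrec f g) ⟨a, m⟩ (cons (FPrec g a m) s)
      end
  | Eval (cMu f) n s =>
      let (a, m) := of_nat n in Eval f n (cons (FMu f a m) s)
  | Ret v nil => Ret v nil
  | Ret v (cons (FPair1 g n) s) => Eval g n (cons (FPair2 v) s)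
  | Ret v (cons (FPair2 u) s) => Ret ⟨u, v⟩ s
  | Ret v (cons (FComp f) s) => Eval f v s
  | Ret v (cons (FPrec g a m) s) => Eval g ⟨a, ⟨m, v⟩⟩ s
  | Ret v (cons (FMu f a m) s) =>
      match v with 0 => Ret m s | S _ => Eval (cMu f) ⟨a, S m⟩ s end
  end.

Definition halted (x : config) : Prop := exists v, x = Ret v nil.

(** Computation histories, latest configuration first; a history is not
    extended beyond a halted configuration. *)
Inductive history (c : code) (n : nat) : list config -> Prop :=
| hist_start : history c n (cons (Eval c n nil) nil)
| hist_step x l : history c n (cons x l) -> ~ halted x ->
    history c n (cons (step x) (cons x l)).

Fixpoint enc_code (c : code) : nat :=
  match c with
  | cZero => ⟨0, 0⟩
  | cSucc => ⟨1, 0⟩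
  | cLeft => ⟨2, 0⟩
  | cRight => ⟨3, 0⟩
  | cPair f g => ⟨4, ⟨enc_code f, enc_code g⟩⟩
  | cComp f g => ⟨5, ⟨enc_code f, enc_code g⟩⟩
  | cPrec f g => ⟨6, ⟨enc_code f, enc_code g⟩⟩
  | cMu f => ⟨7, enc_code f⟩
  end.

Definition enc_frame (x : frame) : nat :=
  match x with
  | FPair1 g n => ⟨0, ⟨enc_code g, n⟩⟩
  | FPair2 u => ⟨1, u⟩
  | FComp f => ⟨2, enc_code f⟩
  | FPrec g a m => ⟨3, ⟨enc_code g, ⟨a, m⟩⟩⟩
  | FMu f a m => ⟨4, ⟨enc_code f, ⟨a, m⟩⟩⟩
  end.

Definition enc_list {A} (enc : A -> nat) (l : list A) : nat :=
  List.fold_right (fun x r => S ⟨enc x, r⟩) 0 l.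

Definition enc_config (x : config) : nat :=
  match x with
  | Eval c n s => ⟨0, ⟨enc_code c, ⟨n, enc_list enc_frame s⟩⟩⟩
  | Ret v s => ⟨1, ⟨v, enc_list enc_frame s⟩⟩
  end.

Definition enc_history : list config -> nat := enc_list enc_config.

Definition mkPair {k} (a b : prim k) := ap2 pPair a b.
Definition mkFst {k} (a : prim k) := ap1 pFst a.
Definition mkSnd {k} (a : prim k) := ap1 pSnd a.
Definition mkEval {k} (c n s : prim k) :=
  mkPair (pConst 0) (mkPair c (mkPair n s)).
Definition mkRet {k} (v s : prim k) := mkPair (pConst 1) (mkPair v s).
Definition mkPush {k} (t : nat) (d s : prim k) :=
  ap1 pSucc (mkPair (mkPair (pConst t) d) s).

Definition pStepEval : prim 1 :=
  let c := mkFst (mkSnd x0) in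
  let b := mkSnd c in
  let f := mkFst b in
  let g := mkSnd b in
  let n := mkFst (mkSnd (mkSnd x0)) in
  let s := mkSnd (mkSnd (mkSnd x0)) in
  let a := mkFst n in
  let m := mkSnd n in
  let m' := ap1 pPred m in
  pSwitch (mkFst c)
    (cons (mkRet (pConst 0) s)
    (cons (mkRet (ap1 pSucc n) s)
    (cons (mkRet a s)
    (cons (mkRet m s)
    (cons (mkEval f n (mkPush 0 (mkPair g n) s))
    (cons (mkEval g n (mkPush 2 f s))
    (cons (ap3 pIfz m
             (mkEval f a s)
             (mkEval c (mkPair a m') (mkPush 3 (mkPair g (mkPair a m')) s)))
    (cons (mkEval b n (mkPush 4 (mkPair b (mkPair a m)) s))
     nil)))))))) x0.

Definition pStepRet : prim 1 :=
  let v := mkFst (mkSnd x0) in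
  let s := mkSnd (mkSnd x0) in
  let fr := mkFst (ap1 pPred s) in
  let s' := mkSnd (ap1 pPred s) in
  let d := mkSnd fr in
  let a := mkFst (mkSnd d) in
  let m := mkSnd (mkSnd d) in
  ap3 pIfz s x0
    (pSwitch (mkFst fr)
      (cons (mkEval (mkFst d) (mkSnd d) (mkPush 1 v s'))
      (cons (mkRet (mkPair d v) s')
      (cons (mkEval d v s')
      (cons (mkEval (mkFst d) (mkPair a (mkPair m v)) s')
      (cons (ap3 pIfz v
               (mkRet m s')
               (mkEval (mkPair (pConst 7) (mkFst d)) (mkPair a (ap1 pSucc m)) s'))
       nil))))) x0).

Definition pStep : prim 1 := ap3 pIfz (mkFst x0) pStepEval pStepRet.

(** [0] exactly on halted configurations *)
Definition pRunning : prim 1 :=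
  ap3 pIfz (mkFst x0) (pConst 1) (mkSnd (mkSnd x0)).

Definition pTop : prim 1 := mkFst (ap1 pPred x0).

(** [(k, e, n)] is sent to the history of program [e] on input [n] after at
    most [k] steps. *)
Definition pHist : prim 3 :=
  pRec (ap1 pSucc (mkPair (mkEval x0 x1 (pConst 0)) (pConst 0)))
       (ap3 pIfz (ap1 pRunning (ap1 pTop x1)) x1
          (ap1 pSucc (mkPair (ap1 pStep (ap1 pTop x1)) x1))).

(** The characteristic function of [T(e, n, q)].  A history with [k] steps has
    a Gödel number [q >= k], so running for [q] steps suffices to check [q]. *)
Definition pT : prim 3 :=
  let h := ap3 pHist x2 x0 x1 in
  ap3 pIfz (ap1 pRunning (ap1 pTop h)) (ap2 pEqb h x2) (pConst 0).

Definition pU : prim 1 := mkFst (mkSnd (ap1 pTop x0)).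

Lemma eval_ap1 k (f : prim 1) (a : prim k) v :
  eval (ap1 f a) v = eval f [eval a v].
Proof. reflexivity. Qed.

Lemma eval_ap2 k (f : prim 2) (a b : prim k) v :
  eval (ap2 f a b) v = eval f [eval a v; eval b v].
Proof. reflexivity. Qed.

Lemma eval_ap3 k (f : prim 3) (a b c : prim k) v :
  eval (ap3 f a b c) v = eval f [eval a v; eval b v; eval c v].
Proof. reflexivity. Qed.

Lemma eval_succ a : eval pSucc [a] = S a.
Proof. reflexivity. Qed.

Lemma eval_rec_0 k (f : prim k) g v : eval (pRec f g) (0 :: v) = eval f v.
Proof. reflexivity. Qed.

Lemma eval_rec_S k (f : prim k) g n v :
  eval (pRec f g) (S n :: v) = eval g (n :: eval (pRec f g) (n :: v) :: v).
Proof. reflexivity. Qed.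

Lemma eval_const k n (v : Vector.t nat k) : eval (pConst n) v = n.
Proof.
  induction n as [|n IH]; [reflexivity|].
  cbn [pConst]. rewrite eval_ap1, eval_succ. now f_equal.
Qed.

Lemma eval_pred a : eval pPred [a] = Nat.pred a.
Proof. destruct a; reflexivity. Qed.

Lemma eval_add a b : eval pAdd [a; b] = a + b.
Proof. induction a as [|a IH]; [reflexivity|]. cbn in *. now rewrite IH. Qed.

Lemma eval_sub a b : eval pSub [a; b] = a - b.
Proof.
  unfold pSub. rewrite eval_ap2. cbn [eval Vector.nth Vector.caseS' Vector.hd].
  induction b as [|b IH]; cbn in *; [lia|].
  rewrite IH. destruct (a - b) eqn:E; cbn; lia.
Qed.

Lemma eval_ifz a b c :
  eval pIfz [a; b; c] = match a with 0 => b | S _ => c end.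
Proof. destruct a; reflexivity. Qed.

Lemma eval_eqb a b : eval pEqb [a; b] = if Nat.eqb a b then 1 else 0.
Proof.
  unfold pEqb.
  rewrite eval_ap3, eval_ifz, !eval_ap2, eval_add, !eval_sub, !eval_const. cbn.
  destruct (Nat.eqb_spec a b) as [->|H].
  - now rewrite Nat.sub_diag.
  - destruct (a - b + (b - a)) eqn:E; [lia|reflexivity].
Qed.

Definition tri (n : nat) : nat := nat_rec (fun _ => nat) 0 (fun i m => S i + m) n.

Lemma eval_tri a : eval pTri [a] = tri a.
Proof.
  induction a as [|a IH]; [reflexivity|].
  change (eval pTri [S a]) with (eval pAdd [S a; eval pTri [a]]).
  now rewrite eval_add, IH.
Qed.

Lemma eval_pair a b : eval pPair [a; b] = ⟨a, b⟩.
Proof.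
  unfold pPair. rewrite eval_ap2, eval_add, eval_ap1, eval_tri, eval_ap2, eval_add.
  reflexivity.
Qed.

Lemma tri_S n : tri (S n) = S n + tri n.
Proof. reflexivity. Qed.

Lemma tri_mono a b : a <= b -> tri a <= tri b.
Proof. induction 1 as [|b H IH]; [lia|]. rewrite tri_S. lia. Qed.

Lemma root_bounds z :
  tri (eval pRoot [z]) <= z < tri (S (eval pRoot [z])).
Proof.
  induction z as [|z IH]; [cbn; lia|].
  change (eval pRoot [S z]) with
    (eval (ap3 pIfz (ap2 pSub (ap1 pTri (ap1 pSucc x1)) (ap1 pSucc x0))
                (ap1 pSucc x1) x1) [z; eval pRoot [z]]).
  rewrite eval_ap3, eval_ifz, eval_ap2, eval_sub, !eval_ap1, eval_tri, !eval_succ.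
  cbn [eval Vector.nth Vector.caseS'].
  set (r := eval pRoot [z]) in *.
  change (eval pRoot [z]) with r.
  destruct (tri (S r) - S z) eqn:E.
  - rewrite !tri_S in *. lia.
  - rewrite !tri_S in *. lia.
Qed.

Lemma eval_root a b : eval pRoot [⟨a, b⟩] = b + a.
Proof.
  pose proof (root_bounds ⟨a, b⟩) as H.
  set (r := eval pRoot [⟨a, b⟩]) in *. clearbody r.
  change ⟨a, b⟩ with (b + tri (b + a)) in H.
  destruct (Nat.lt_trichotomy r (b + a)) as [L|[L|L]]; [|exact L|].
  - pose proof (tri_mono (S r) (b + a) L). lia.
  - pose proof (tri_mono (S (b + a)) r L) as M. rewrite tri_S in M. lia.
Qed.

Lemma eval_snd_pair a b : eval pSnd [⟨a, b⟩] = b.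
Proof.
  unfold pSnd. rewrite eval_ap2, eval_sub, !eval_ap1, eval_tri.
  cbn [eval Vector.nth Vector.caseS']. fold (eval pRoot [⟨a, b⟩]).
  rewrite eval_root. change ⟨a, b⟩ with (b + tri (b + a)). lia.
Qed.

Lemma eval_fst_pair a b : eval pFst [⟨a, b⟩] = a.
Proof.
  unfold pFst. rewrite eval_ap2, eval_sub, !eval_ap1.
  cbn [eval Vector.nth Vector.caseS'].
  rewrite eval_root, eval_snd_pair. lia.
Qed.

Lemma eval_fst a : eval pFst [a] = fst (of_nat a).
Proof.
  destruct (of_nat a) as [x y] eqn:E.
  rewrite <- (cancel_to_of a), E. apply eval_fst_pair.
Qed.

Lemma eval_snd a : eval pSnd [a] = snd (of_nat a).
Proof.
  destruct (of_nat a) as [x y] eqn:E.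
  rewrite <- (cancel_to_of a), E. apply eval_snd_pair.
Qed.

Lemma eval_x0 k (a : nat) (v : Vector.t nat k) : eval x0 (a :: v) = a.
Proof. reflexivity. Qed.
Lemma eval_x1 k (a b : nat) (v : Vector.t nat k) : eval x1 (a :: b :: v) = b.
Proof. reflexivity. Qed.
Lemma eval_x2 k (a b c : nat) (v : Vector.t nat k) :
  eval x2 (a :: b :: c :: v) = c.
Proof. reflexivity. Qed.

Ltac prim_simp :=
  repeat (rewrite ?eval_ap1, ?eval_ap2, ?eval_ap3, ?eval_const, ?eval_ifz,
            ?eval_eqb, ?eval_pair, ?eval_fst_pair, ?eval_snd_pair, ?eval_fst,
            ?eval_snd, ?eval_pred, ?eval_succ, ?eval_x0, ?eval_x1, ?eval_x2,
            ?cancel_of_to;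
          cbn [fst snd Nat.pred]).

Lemma eval_switch k (t : prim k) l d v :
  eval (pSwitch t l d) v = eval (List.nth (eval t v) l d) v.
Proof.
  revert t. induction l as [|a l IH]; intros t; cbn [pSwitch].
  - now destruct (eval t v).
  - rewrite eval_ap3, eval_ifz, IH, eval_ap1, eval_pred.
    now destruct (eval t v).
Qed.

Lemma eval_step x : eval pStep [enc_config x] = enc_config (step x).
Proof.
  unfold pStep, mkFst. rewrite eval_ap3, eval_ifz, eval_ap1, eval_x0, eval_fst.
  destruct x as [c n s|v s]; cbn [enc_config]; rewrite cancel_of_to; cbn [fst].
  - unfold pStepEval. cbv zeta. rewrite eval_switch.
    unfold mkFst at 1, mkFst at 1, mkSnd at 1.
    destruct c as [| | | |f g|f g|f g|f]; cbn [enc_code]; prim_simp;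
      cbn [List.nth]; unfold mkEval, mkRet, mkPush, mkPair, mkFst, mkSnd;
      prim_simp; cbn [step]; [reflexivity..| |];
      destruct (of_nat n) as [a [|m]]; reflexivity.
  - unfold pStepRet. cbv zeta.
    rewrite eval_ap3, eval_switch, eval_ifz.
    unfold mkFst at 1, mkFst at 1, mkSnd at 1, mkSnd at 1.
    destruct s as [|[g n|u|f|g a m|f a m] s];
      cbn [enc_list List.fold_right enc_frame]; unfold mkSnd at 1 2;
      prim_simp; [reflexivity|..];
      cbn [List.nth]; unfold mkEval, mkRet, mkPush, mkPair, mkFst, mkSnd;
      prim_simp; cbn [step]; [reflexivity..|].
    destruct v; reflexivity.
Qed.

Lemma halted_dec x : {halted x} + {~ halted x}.
Proof.
  destruct x as [c n s|v [|fr s]].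
  - right. now intros [? ?].
  - left. now exists v.
  - right. now intros [? ?].
Defined.

Lemma eval_running x : eval pRunning [enc_config x] = 0 <-> halted x.
Proof.
  unfold pRunning, mkFst, mkSnd. prim_simp.
  destruct x as [c n s|v [|fr s]]; cbn [enc_config]; prim_simp.
  - split; [discriminate|now intros [? ?]].
  - split; [now exists v|reflexivity].
  - split; [discriminate|now intros [? ?]].
Qed.

Lemma eval_top x l : eval pTop [enc_history (cons x l)] = enc_config x.
Proof. unfold pTop, mkFst, enc_history. cbn [enc_list List.fold_right]. now prim_simp. Qed.

Lemma eval_U v l : eval pU [enc_history (cons (Ret v nil) l)] = v.
Proof.
  unfold pU, mkFst, mkSnd. prim_simp. rewrite eval_top. cbn [enc_config].
  now prim_simp.
Qed.

Lemma eval_hist0 e n : eval pHist [0; e; n] = S ⟨⟨0, ⟨e, ⟨n, 0⟩⟩⟩, 0⟩.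
Proof.
  unfold pHist. rewrite eval_rec_0.
  unfold mkEval, mkPair. now prim_simp.
Qed.

Lemma eval_histS k e n h x l :
  eval pHist [k; e; n] = h -> h = enc_history (cons x l) ->
  eval pHist [S k; e; n] =
    if halted_dec x then h else enc_history (cons (step x) (cons x l)).
Proof.
  intros Hh Hx. unfold pHist. rewrite eval_rec_S. fold pHist. rewrite Hh.
  unfold mkPair. rewrite eval_ap3, eval_ifz. prim_simp.
  rewrite Hx, eval_top, eval_step.
  pose proof (eval_running x) as R.
  destruct (halted_dec x) as [H|H].
  - apply R in H. now rewrite H.
  - destruct (eval pRunning [enc_config x]); [tauto|reflexivity].
Qed.

Lemma hist_history c n k :
  exists x l, eval pHist [k; enc_code c; n] = enc_history (cons x l) /\
    history c n (cons x l).
Proof.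
  induction k as [|k (x & l & E & H)].
  - exists (Eval c n nil), nil. rewrite eval_hist0. split; [reflexivity|constructor].
  - rewrite (eval_histS _ _ _ _ _ _ E eq_refl).
    destruct (halted_dec x) as [h|h].
    + exists x, l. split; [reflexivity|exact H].
    + exists (step x), (cons x l). split; [reflexivity|now constructor].
Qed.

Lemma history_hist c n l : history c n l ->
  eval pHist [pred (length l); enc_code c; n] = enc_history l.
Proof.
  induction 1 as [|x l H IH Hx].
  - exact (eval_hist0 _ _).
  - cbn [length pred] in *. rewrite (eval_histS _ _ _ _ _ _ IH eq_refl).
    now destruct (halted_dec x).
Qed.

Lemma hist_stable c n k x l :
  eval pHist [k; enc_code c; n] = enc_history (cons x l) -> halted x ->
  forall j, k <= j -> eval pHist [j; enc_code c; n] = enc_history (cons x l).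
Proof.
  intros E Hx j. induction 1 as [|j _ IH]; [exact E|].
  rewrite (eval_histS _ _ _ _ _ _ IH eq_refl). now destruct (halted_dec x).
Qed.

Lemma length_enc l : length l <= enc_history l.
Proof.
  induction l as [|x l IH]; [apply le_n|].
  cbn [length]. unfold enc_history in *. cbn [enc_list List.fold_right].
  fold (enc_list enc_config l).
  pose proof (to_nat_non_decreasing (enc_config x) (enc_list enc_config l)). lia.
Qed.

Lemma T_spec c n q :
  eval pT [enc_code c; n; q] = 1 <->
  exists v l, history c n (cons (Ret v nil) l) /\
    q = enc_history (cons (Ret v nil) l).
Proof.
  unfold pT. cbv zeta. rewrite eval_ap3, eval_ifz, eval_ap2, eval_eqb, !eval_ap1.
  rewrite eval_ap3, eval_const, eval_x0, eval_x1, eval_x2.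
  split.
  - destruct (hist_history c n q) as (x & l & E & H). rewrite E, eval_top.
    destruct (eval pRunning [enc_config x]) eqn:R; [|discriminate].
    apply eval_running in R. destruct R as [v ->].
    destruct (Nat.eqb_spec (enc_history (cons (Ret v nil) l)) q) as [Eq|];
      [|discriminate].
    intros _. exists v, l. split; [exact H|symmetry; exact Eq].
  - intros (v & l & H & Eq).
    assert (E : eval pHist [q; enc_code c; n] = enc_history (cons (Ret v nil) l)).
    { apply history_hist in H as E. eapply hist_stable; [exact E|now exists v|].
      pose proof (length_enc (cons (Ret v nil) l)). rewrite Eq. lia. }
    rewrite E, eval_top, (proj2 (eval_running (Ret v nil))) by now exists v.
    rewrite Eq, Nat.eqb_refl. reflexivity.
Qed.

Lemma T_or c n q : eval pT [enc_code c; n; q] = 0 \/ eval pT [enc_code c; n; q] = 1.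
Proof.
  unfold pT. cbv zeta. rewrite eval_ap3, eval_ifz, eval_ap2, eval_eqb.
  destruct (eval _ _); [destruct (Nat.eqb _ _)|]; rewrite ?eval_const; auto.
Qed.

Fixpoint steps (j : nat) (x : config) : config :=
  match j with 0 => x | S j => steps j (step x) end.

Lemma steps_add i j x : steps (i + j) x = steps j (steps i x).
Proof. revert x. induction i as [|i IH]; intros x; [reflexivity|apply IH]. Qed.

Lemma computes_steps c n w : computes c n w ->
  forall s, exists i, steps i (Eval c n s) = Ret w s.
Proof.
  induction 1 as [n|n|a b|a b|f g n a b Hf IHf Hg IHg|f g n a b Hg IHg Hf IHf
    |f g a r Hf IHf|f g a m r t Hr IHr Ht IHt|f a m Hf IHf
    |f a m k r Hf IHf Hr IHr]; intros s.
  - now exists 1.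
  - now exists 1.
  - exists 1. cbn. now rewrite cancel_of_to.
  - exists 1. cbn. now rewrite cancel_of_to.
  - destruct (IHf (cons (FPair1 g n) s)) as [i Hi].
    destruct (IHg (cons (FPair2 a) s)) as [j Hj].
    exists (S (i + S (j + 1))). cbn [steps step].
    rewrite steps_add, Hi. cbn [steps step]. now rewrite steps_add, Hj.
  - destruct (IHg (cons (FComp f) s)) as [i Hi]. destruct (IHf s) as [j Hj].
    exists (S (i + S j)). cbn [steps step]. now rewrite steps_add, Hi.
  - destruct (IHf s) as [i Hi]. exists (S i). cbn [steps step].
    now rewrite cancel_of_to.
  - destruct (IHr (cons (FPrec g a m) s)) as [i Hi]. destruct (IHt s) as [j Hj].
    exists (S (i + S j)). cbn [steps step]. rewrite cancel_of_to.
    now rewrite steps_add, Hi.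
  - destruct (IHf (cons (FMu f a m) s)) as [i Hi]. exists (S (i + 1)).
    cbn [steps step]. rewrite cancel_of_to. now rewrite steps_add, Hi.
  - destruct (IHf (cons (FMu f a m) s)) as [i Hi]. destruct (IHr s) as [j Hj].
    exists (S (i + S j)). cbn [steps step]. rewrite cancel_of_to.
    now rewrite steps_add, Hi.
Qed.

Lemma steps_computes j : forall c n s v, steps j (Eval c n s) = Ret v nil ->
  exists i w, i < j /\ computes c n w /\ steps i (Ret w s) = Ret v nil.
Proof.
  induction j as [j IH] using (well_founded_induction lt_wf).
  intros c n s v E. destruct j as [|j]; [discriminate|]. cbn [steps] in E.
  destruct c as [| | | |f g|f g|f g|f]; cbn [step] in E.
  - exists j, 0. repeat split; [lia|constructor|exact E].
  - exists j, (S n). repeat split; [lia|constructor|exact E].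
  - exists j, (fst (of_nat n)). repeat split; [lia| |exact E].
    destruct (of_nat n) as [x y] eqn:En.
    rewrite <- (cancel_to_of n), En. constructor.
  - exists j, (snd (of_nat n)). repeat split; [lia| |exact E].
    destruct (of_nat n) as [x y] eqn:En.
    rewrite <- (cancel_to_of n), En. constructor.
  - apply IH in E as (i & a & Hi & Ha & E); [|lia].
    destruct i as [|i]; [discriminate|]. cbn [steps step] in E.
    apply IH in E as (i' & b & Hi' & Hb & E); [|lia].
    destruct i' as [|i']; [discriminate|]. cbn [steps step] in E.
    exists i', ⟨a, b⟩. repeat split; [lia|now constructor|exact E].
  - apply IH in E as (i & a & Hi & Ha & E); [|lia].
    destruct i as [|i]; [discriminate|]. cbn [steps step] in E.
    apply IH in E as (i' & b & Hi' & Hb & E); [|lia].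
    exists i', b. repeat split; [lia|now econstructor; eauto|exact E].
  - rewrite <- (cancel_to_of n). destruct (of_nat n) as [a [|m]].
    + apply IH in E as (i & r & Hi & Hr & E); [|lia].
      exists i, r. repeat split; [lia|now constructor|exact E].
    + apply IH in E as (i & r & Hi & Hr & E); [|lia].
      destruct i as [|i]; [discriminate|]. cbn [steps step] in E.
      apply IH in E as (i' & t & Hi' & Ht & E); [|lia].
      exists i', t. repeat split; [lia|now econstructor; eauto|exact E].
  - rewrite <- (cancel_to_of n) in E |- *. rewrite cancel_of_to in E.
    destruct (of_nat n) as [a m].
    apply IH in E as (i & r & Hi & Hr & E); [|lia].
    destruct i as [|i]; [discriminate|]. cbn [steps step] in E.
    destruct r as [|r].
    + exists i, m. repeat split; [lia|now constructor|exact E].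
    + apply IH in E as (i' & t & Hi' & Ht & E); [|lia].
      exists i', t. repeat split; [lia|now econstructor; eauto|exact E].
Qed.

Lemma history_steps c n l : history c n l ->
  exists j x l', l = cons x l' /\ steps j (Eval c n nil) = x.
Proof.
  induction 1 as [|x l H (j & x' & l' & E & Hj) Hx].
  - now exists 0, (Eval c n nil), nil.
  - injection E as <- <-. exists (j + 1), (step x), (cons x l).
    split; [reflexivity|]. now rewrite steps_add, Hj.
Qed.

Lemma steps_history c n j :
  exists l, history c n (cons (steps j (Eval c n nil)) l).
Proof.
  induction j as [|j [l H]].
  - exists nil. constructor.
  - rewrite <- Nat.add_1_r, steps_add. cbn [steps].
    destruct (halted_dec (steps j (Eval c n nil))) as [[v E]|h].
    + exists l. rewrite E in *. exact H.
    + eexists. constructor; [exact H|exact h].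
Qed.

Theorem T_U_computes c n m :
  (exists q, eval pT [enc_code c; n; q] = 1 /\ eval pU [q] = m) <->
  computes c n m.
Proof.
  split.
  - intros (q & HT & HU). apply T_spec in HT as (v & l & H & ->).
    rewrite eval_U in HU. subst v.
    apply history_steps in H as (j & x & l' & E & Hj). injection E as <- <-.
    apply steps_computes in Hj as (i & w & _ & Hw & E).
    destruct i; cbn in E.
    + now injection E as ->.
    + assert (F : forall i, steps i (Ret w nil) = Ret w nil)
        by (clear; induction i; [reflexivity|assumption]).
      rewrite F in E. now injection E as ->.
  - intros H. destruct (computes_steps _ _ _ H nil) as [j Hj].
    destruct (steps_history c n j) as [l Hl]. rewrite Hj in Hl.
    exists (enc_history (cons (Ret m nil) l)). rewrite eval_U. split; [|reflexivity].
    apply T_spec. now exists m, l.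
Qed.

(** The function symbols are the elements of [prim]; [0] and [S] are [pZero]
    and [pSucc].  Variables are de Bruijn indices. *)
Inductive term : Type :=
| Var (n : nat)
| Fn {k} (f : prim k) (ts : Vector.t term k).

Inductive form : Type :=
| Eq (s t : term)
| Bot
| And (φ ψ : form)
| Or (φ ψ : form)
| Imp (φ ψ : form)
| All (φ : form)
| Ex (φ : form)
| Box (φ : form).

Definition Neg (φ : form) : form := Imp φ Bot.
Definition Iff (φ ψ : form) : form := And (Imp φ ψ) (Imp ψ φ).

Fixpoint tsubst (σ : nat -> term) (t : term) : term :=
  match t with
  | Var n => σ n
  | Fn f ts => Fn f (Vector.map (tsubst σ) ts)
  end.

Definition up (σ : nat -> term) (n : nat) : term :=
  match n with 0 => Var 0 | S n => tsubst (fun i => Var (S i)) (σ n) end.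

Fixpoint subst (σ : nat -> term) (φ : form) : form :=
  match φ with
  | Eq s t => Eq (tsubst σ s) (tsubst σ t)
  | Bot => Bot
  | And φ ψ => And (subst σ φ) (subst σ ψ)
  | Or φ ψ => Or (subst σ φ) (subst σ ψ)
  | Imp φ ψ => Imp (subst σ φ) (subst σ ψ)
  | All φ => All (subst (up σ) φ)
  | Ex φ => Ex (subst (up σ) φ)
  | Box φ => Box (subst σ φ)
  end.

Definition rename (ρ : nat -> nat) : form -> form := subst (fun n => Var (ρ n)).

(** [shift φ] is [φ] weakened by a fresh variable of index [0]. *)
Definition shift : form -> form := rename S.

(** [inst φ t] is [φ(t)] where the displayed variable of [φ(x)] has index [0]. *)
Definition inst (φ : form) (t : term) : form :=
  subst (fun n => match n with 0 => t | S n => Var n end) φ.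

(** Atomic, quantified and boxed formulas are the propositional atoms. *)
Fixpoint prop_eval (v : form -> bool) (φ : form) : bool :=
  match φ with
  | Bot => false
  | And φ ψ => andb (prop_eval v φ) (prop_eval v ψ)
  | Or φ ψ => orb (prop_eval v φ) (prop_eval v ψ)
  | Imp φ ψ => implb (prop_eval v φ) (prop_eval v ψ)
  | _ => v φ
  end.

Definition tautology (φ : form) : Prop := forall v, prop_eval v φ = true.

Definition swap01 (n : nat) : nat :=
  match n with 0 => 1 | 1 => 0 | n => n end.

Inductive QK_base : form -> Prop :=
| ax_taut φ : tautology φ -> QK_base φ
| ax_K φ ψ : QK_base (Imp (Box (Imp φ ψ)) (Imp (Box φ) (Box ψ)))
| ax_vacuous φ : QK_base (Iff (All (shift φ)) φ)
| ax_all_imp φ ψ : QK_base (Imp (All (Imp φ ψ)) (Imp (All φ) (All ψ)))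
| ax_all_comm φ : QK_base (Iff (All (All φ)) (All (All (rename swap01 φ))))
| ax_ex φ : QK_base (Iff (Ex φ) (Neg (All (Neg φ)))).

(** [∀y ((∀x φ(x)) ⇒ φ(y))].  Under [∀y], index [0] is [y], and [φ] may contain
    [y] as a parameter. *)
Inductive UI_closed : form -> Prop :=
| ui_closed φ : UI_closed (All (Imp (All φ) (inst φ (Var 0)))).

(** [(∀x φ(x)) ⇒ φ(y)] with [y] free *)
Inductive UI_free : form -> Prop :=
| ui_free φ y : UI_free (Imp (All φ) (inst φ (Var y))).

Inductive S4_axiom : form -> Prop :=
| ax_T φ : S4_axiom (Imp (Box φ) φ)
| ax_4 φ : S4_axiom (Imp (Box φ) (Box (Box φ))).

Inductive eq_axiom : form -> Prop :=
| ax_refl t : eq_axiom (Eq t t)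
| ax_leibniz φ s t : eq_axiom (Imp (Eq s t) (Imp (inst φ t) (inst φ s))).

Definition QeqS4_closed (φ : form) : Prop :=
  QK_base φ \/ UI_closed φ \/ S4_axiom φ \/ eq_axiom φ.

Definition QeqS4_free (φ : form) : Prop :=
  QK_base φ \/ UI_free φ \/ S4_axiom φ \/ eq_axiom φ.

(** Theorems of the system with axioms [Ax].  In [prv_gen] the generalized
    variable is index [0]. *)
Inductive prv (Ax : form -> Prop) : form -> Prop :=
| prv_ax φ : Ax φ -> prv Ax φ
| prv_mp φ ψ : prv Ax (Imp φ ψ) -> prv Ax φ -> prv Ax ψ
| prv_gen φ : prv Ax φ -> prv Ax (All φ)
| prv_nec φ : prv Ax φ -> prv Ax (Box φ).

(** The formulas of [Γ] are assumptions, to which generalization and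
    necessitation do not apply: already in S4, [Box (Neg β)] is refutable for
    every instance [β] of the Barcan formula. *)
Definition consistent_with (Ax : form -> Prop) (Γ : list form) : Prop :=
  ~ prv Ax (List.fold_right Imp Bot Γ).

Definition tzero : term := Fn pZero [].
Definition tsucc (t : term) : term := Fn pSucc [t].

Fixpoint vars (n k : nat) : Vector.t term k :=
  match k with 0 => [] | S k => Var n :: vars (S n) k end.

Definition alls (k : nat) (φ : form) : form := Nat.iter k All φ.

(** [pa_total] is a theorem of PA over classical first-order logic, where
    instantiation by terms is available.  The logics above instantiate by
    variables only, so it is stated explicitly.  In [pa_ind] the formula [φ] is
    arbitrary, in particular it may contain [Box]. *)
Inductive PA : form -> Prop :=
| pa_succ_zero : PA (All (Neg (Eq (tsucc (Var 0)) tzero)))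
| pa_succ_inj :
    PA (All (All (Imp (Eq (tsucc (Var 0)) (tsucc (Var 1))) (Eq (Var 0) (Var 1)))))
| pa_total k (f : prim k) :
    PA (alls k (Ex (Eq (Fn f (vars 1 k)) (Var 0))))
| pa_proj k (i : Fin.t k) :
    PA (alls k (Eq (Fn (pProj i) (vars 0 k)) (Vector.nth (vars 0 k) i)))
| pa_comp k m (f : prim m) (gs : Vector.t (prim k) m) :
    PA (alls k (Eq (Fn (pComp f gs) (vars 0 k))
                   (Fn f (Vector.map (fun g => Fn g (vars 0 k)) gs))))
| pa_rec_zero k (f : prim k) (g : prim (S (S k))) :
    PA (alls k (Eq (Fn (pRec f g) (tzero :: vars 0 k)) (Fn f (vars 0 k))))
| pa_rec_succ k (f : prim k) (g : prim (S (S k))) :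
    PA (alls (S k)
         (Eq (Fn (pRec f g) (tsucc (Var 0) :: vars 1 k))
             (Fn g (Var 0 :: Fn (pRec f g) (Var 0 :: vars 1 k) :: vars 1 k))))
| pa_ind φ :
    PA (Imp (inst φ tzero)
         (Imp (All (Imp φ (subst (fun n => match n with
                                           | 0 => tsucc (Var 0)
                                           | S n => Var (S n)
                                           end) φ)))
              (All φ))).

Definition EA_closed (φ : form) : Prop := QeqS4_closed φ \/ PA φ.

Definition EA (φ : form) : Prop := QeqS4_free φ \/ PA φ.

Inductive BF : form -> Prop :=
| bf φ : BF (Imp (All (Box φ)) (Box (All φ))).

Inductive CBF : form -> Prop :=
| cbf φ : CBF (Imp (Box (All φ)) (All (Box φ))).

Definition kleene_T (e n q : term) : form := Eq (Fn pT [e; n; q]) (tsucc tzero).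
Definition kleene_U (q m : term) : form := Eq (Fn pU [q]) m.

(** In [φ(n, m)], [m] has index [0] and [n] index [1].  On the right the bound
    variables [e, n, m, q] have indices [3, 2, 1, 0]. *)
Inductive ECT : form -> Prop :=
| ect φ : ECT
    (Imp (Box (All (Ex (Box φ))))
         (Ex (Box (All (Ex (Ex
            (And (kleene_T (Var 3) (Var 2) (Var 0))
            (And (kleene_U (Var 0) (Var 1))
                 (Box (rename (fun i => match i with
                                        | 0 => 1
                                        | 1 => 2
                                        | S (S i) => i + 4
                                        end) φ)))))))))).

(* Main.v *)
Require Import Defs.
From Stdlib Require Import List Classical ClassicalEpsilon FunctionalExtensionality.
Import Vector.VectorNotations.
Local Close Scope vector_scope.

(** A realizability model in the manner of Flagg, over Kleene's first algebra.
    A formula is interpreted relative to every set [x] of numbers (a "stage"),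
    by the Friedman translation that puts [x] in the place of falsity; so the
    logic at each stage is classical.  [Box φ] holds if [φ] has a realizer that
    works at all stages at once.  A realizer of [□ ∀n ∃m □ φ] can then be run at
    the stage consisting of the pairs of an [m] and a realizer of [φ(n, m)];
    there it outputs such a pair, which yields ECT.

    Quantifiers are relativized to numbers, given to realizers as inputs, while
    free variables range over a larger domain and carry no computational
    information.  The closed form of instantiation and CBF are realized.  At the
    empty stage truth is two-valued, and [Box] means having a realizer.  There,
    free instantiation fails at a nonexistent individual, and BF fails for an
    undecidable property each of whose instances is separately decided. *)

(** * Programs *)

Lemma steps_halted i v : steps i (Ret v nil) = Ret v nil.
Proof. induction i as [|i IH]; [reflexivity|exact IH]. Qed.

Lemma computes_functional c n a b : computes c n a -> computes c n b -> a = b.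
Proof.
  intros Ha Hb.
  destruct (computes_steps _ _ _ Ha nil) as [i Hi].
  destruct (computes_steps _ _ _ Hb nil) as [j Hj].
  assert (E : steps (i + j) (Eval c n nil) = steps (j + i) (Eval c n nil))
    by now rewrite Nat.add_comm.
  rewrite !steps_add, Hi, Hj, !steps_halted in E. now injection E.
Qed.

(** Unpairing and pairing again is the identity because Cantor pairing is onto. *)
Definition cId : code := cPair cLeft cRight.

Lemma computes_id n : computes cId n n.
Proof.
  rewrite <- (cancel_to_of n). destruct (of_nat n) as [a b].
  apply ev_pair; constructor.
Qed.

Fixpoint cConst (z : nat) : code :=
  match z with 0 => cZero | S z => cComp cSucc (cConst z) end.

Lemma computes_const z n : computes (cConst z) n z.
Proof. induction z; cbn; repeat econstructor; eassumption. Qed.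

(** Recursion on the number to be quoted, with [0] as a dummy parameter: each round wraps one more
    [cComp cSucc] around the program, [5] being the tag of [cComp] in [enc_code]. *)
Definition cQuote : code :=
  cComp (cPrec (cConst (enc_code cZero))
          (cPair (cConst 5) (cPair (cConst (enc_code cSucc)) (cComp cRight cRight))))
        (cPair cZero cId).

Lemma computes_quote z : computes cQuote z (enc_code (cConst z)).
Proof.
  eapply ev_comp; [apply ev_pair; [constructor|apply computes_id]|].
  induction z as [|z IH].
  - apply ev_prec0, computes_const.
  - eapply ev_precS; [exact IH|].
    change (enc_code (cConst (S z))) with
      ⟨5, ⟨enc_code cSucc, enc_code (cConst z)⟩⟩.
    apply ev_pair; [apply computes_const|].
    apply ev_pair; [apply computes_const|].
    eapply ev_comp; constructor.
Qed.

Definition closure (c : code) (v : nat) : code := cComp c (cPair cId (cConst v)).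

(** The s-m-n theorem: the number of [closure c v] is assembled from [v], with [5] and [4] the tags
    of [cComp] and [cPair]. *)
Definition cLam (c : code) : code :=
  cPair (cConst 5) (cPair (cConst (enc_code c))
    (cPair (cConst 4) (cPair (cConst (enc_code cId)) cQuote))).

Lemma computes_lam c v : computes (cLam c) v (enc_code (closure c v)).
Proof.
  change (enc_code (closure c v)) with
    ⟨5, ⟨enc_code c, ⟨4, ⟨enc_code cId, enc_code (cConst v)⟩⟩⟩⟩.
  repeat (apply ev_pair; [apply computes_const|]). apply computes_quote.
Qed.

Lemma computes_closure c v n m :
  computes c ⟨n, v⟩ m -> computes (closure c v) n m.
Proof.
  intros H. eapply ev_comp; [|exact H].
  apply ev_pair; [apply computes_id|apply computes_const].
Qed.

Definition enc_vec {k} (u : Vector.t nat k) : nat :=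
  Vector.fold_right (fun a r => ⟨a, r⟩) u 0.

Fixpoint compile {k} (f : prim k) : code :=
  match f with
  | pZero => cZero
  | pSucc => cComp cSucc cLeft
  | pProj i =>
      (fix nthc {k} (i : Fin.t k) : code :=
         match i with
         | Fin.F1 => cLeft
         | Fin.FS i => cComp (nthc i) cRight
         end) _ i
  | pComp f gs =>
      cComp (compile f)
        (Vector.fold_right (fun g r => cPair (compile g) r) gs cZero)
  | pRec f g =>
      cComp (cPrec (compile f)
              (cComp (compile g)
                 (cPair (cComp cLeft cRight)
                    (cPair (cComp cRight cRight) cLeft))))
            (cPair cRight cLeft)
  end.

Lemma compile_correct : forall k (f : prim k) u,
  computes (compile f) (enc_vec u) (eval f u).
Proof.
  fix IH 2. intros k f u. destruct f as [| |k i|k m f gs|k f g].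
  - constructor.
  - rewrite (Vector.eta u). eapply ev_comp; constructor.
  - cbn [compile eval].
    induction i as [k|k i IHi]; rewrite (Vector.eta u).
    + constructor.
    + eapply ev_comp; [constructor|apply IHi].
  - eapply ev_comp; [|exact (IH _ f _)]. clear f.
    induction gs as [|g m gs IHgs]; [constructor|].
    apply ev_pair; [apply IH|exact IHgs].
  - rewrite (Vector.eta u). generalize (Vector.hd u) (Vector.tl u). clear u.
    intros a u. eapply ev_comp; [apply ev_pair; constructor|].
    induction a as [|a IHa].
    + apply ev_prec0. exact (IH _ f u).
    + eapply ev_precS; [exact IHa|].
      eapply ev_comp; [|exact (IH _ g (a :: eval (pRec f g) (a :: u) :: u)%vector)].
      apply ev_pair; [eapply ev_comp; constructor|].
      apply ev_pair; [eapply ev_comp; constructor|constructor].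
Qed.

(** On [⟨⟨e, n⟩, q⟩]: zero exactly if [T(e, n, q)]. *)
Definition cTest : code :=
  cComp (compile (ap2 pSub (pConst 1) pT))
    (cPair (cComp cLeft cLeft)
       (cPair (cComp cRight cLeft) (cPair cRight cZero))).

Lemma computes_test e n q :
  computes cTest ⟨⟨e, n⟩, q⟩ (1 - eval pT [e; n; q]%vector).
Proof.
  eapply ev_comp.
  - apply ev_pair; [eapply ev_comp; constructor|].
    apply ev_pair; [eapply ev_comp; constructor|].
    apply ev_pair; constructor.
  - change ⟨e, ⟨n, ⟨q, 0⟩⟩⟩ with (enc_vec [e; n; q]%vector).
    assert (H := compile_correct _ (ap2 pSub (pConst 1) pT) [e; n; q]%vector).
    rewrite eval_ap2, eval_sub, eval_const in H. exact H.
Qed.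

Definition cSearch : code := cComp (cMu cTest) (cPair cId cZero).

Lemma computes_search c n m : computes c n m ->
  exists q, computes cSearch ⟨enc_code c, n⟩ q /\
    eval pT [enc_code c; n; q]%vector = 1 /\ eval pU [q]%vector = m.
Proof.
  intros H. destruct (proj2 (T_U_computes c n m) H) as (q & Hq & _).
  (* Induction on the distance [d] from the candidate [b] to a history [q] known to exist, which
     bounds the search. *)
  assert (G : forall d b, b + d = q -> exists q',
    computes (cMu cTest) ⟨⟨enc_code c, n⟩, b⟩ q' /\
    eval pT [enc_code c; n; q']%vector = 1).
  { induction d as [|d IH]; intros b E;
      assert (Hb := computes_test (enc_code c) n b);
      destruct (T_or c n b) as [F|F]; rewrite F in Hb.
    - rewrite Nat.add_0_r in E. subst b. congruence.
    - exists b. split; [now apply ev_mu0|exact F].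
    - destruct (IH (S b)) as (q' & Hq' & HT); [lia|].
      exists q'. split; [eapply ev_muS; eassumption|exact HT].
    - exists b. split; [now apply ev_mu0|exact F]. }
  destruct (G q 0 eq_refl) as (q' & Hq' & HT).
  exists q'. split; [|split; [exact HT|]].
  - eapply ev_comp; [|exact Hq']. apply ev_pair; [apply computes_id|constructor].
  (* The history found is not assumed to be [q]; its output is right because programs are
     deterministic. *)
  - apply (computes_functional c n); [|exact H].
    apply T_U_computes. exists q'. split; [exact HT|reflexivity].
Qed.

Definition cUniv : code :=
  cComp (compile pU) (cPair cSearch cZero).

Lemma computes_univ c n m :
  computes c n m -> computes cUniv ⟨enc_code c, n⟩ m.
Proof.
  intros H. destruct (computes_search c n m H) as (q & Hq & _ & <-).
  eapply ev_comp; [|exact (compile_correct _ pU [q]%vector)].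
  apply ev_pair; [exact Hq|constructor].
Qed.

(** * Realizability *)

Definition imp (X Y : nat -> Prop) (e : nat) : Prop :=
  exists c, e = enc_code c /\
    forall n, X n -> exists m, computes c n m /\ Y m.

(** A typing judgement, [v] being the context. The rules below follow natural deduction; applied
    with [c] an existential variable, they synthesize the realizer along with the proof. *)
Definition J (c : code) (v : nat) (X : nat -> Prop) : Prop :=
  exists m, computes c v m /\ X m.

Lemma J_var (X : nat -> Prop) a v : X a -> J cLeft ⟨a, v⟩ X.
Proof. exists a. split; [constructor|assumption]. Qed.

Lemma J_id (X : nat -> Prop) a : X a -> J cId a X.
Proof. exists a. split; [apply computes_id|assumption]. Qed.

Lemma J_comp f g v (X Y : nat -> Prop) :
  J g v X -> (forall a, X a -> J f a Y) -> J (cComp f g) v Y.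
Proof.
  intros (a & Ha & Xa) H. destruct (H a Xa) as (b & Hb & Yb).
  exists b. split; [econstructor; eassumption|assumption].
Qed.

Lemma J_weak c a v X : J c v X -> J (cComp c cRight) ⟨a, v⟩ X.
Proof.
  intros (m & Hm & Xm). exists m.
  split; [econstructor; [constructor|exact Hm]|exact Xm].
Qed.

Lemma J_pair f g v (X Y Z : nat -> Prop) : J f v X -> J g v Y ->
  (forall a b, X a -> Y b -> Z ⟨a, b⟩) -> J (cPair f g) v Z.
Proof.
  intros (a & Ha & Xa) (b & Hb & Yb) H. exists ⟨a, b⟩.
  split; [now constructor|auto].
Qed.

Lemma J_const (X : nat -> Prop) z v : X z -> J (cConst z) v X.
Proof. exists z. split; [apply computes_const|assumption]. Qed.

Lemma J_lam c v (X Y : nat -> Prop) :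
  (forall a, X a -> J c ⟨a, v⟩ Y) -> J (cLam c) v (imp X Y).
Proof.
  intros H. exists (enc_code (closure c v)). split; [apply computes_lam|].
  exists (closure c v). split; [reflexivity|].
  intros n Xn. destruct (H n Xn) as (m & Hm & Ym).
  exists m. split; [now apply computes_closure|exact Ym].
Qed.

Definition cApp (f g : code) : code := cComp cUniv (cPair f g).

Lemma J_app f g v (X Y : nat -> Prop) :
  J f v (imp X Y) -> J g v X -> J (cApp f g) v Y.
Proof.
  intros (e & He & c & -> & Hc) (a & Ha & Xa).
  destruct (Hc a Xa) as (m & Hm & Ym). exists m. split; [|exact Ym].
  eapply ev_comp; [apply ev_pair; eassumption|now apply computes_univ].
Qed.

Definition cLet (f c : code) : code := cComp c (cPair f cId).

Lemma J_let f c v (X Y : nat -> Prop) :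
  J f v X -> (forall a, X a -> J c ⟨a, v⟩ Y) -> J (cLet f c) v Y.
Proof.
  intros (a & Ha & Xa) H. destruct (H a Xa) as (m & Hm & Ym).
  exists m. split; [|exact Ym].
  eapply ev_comp; [apply ev_pair; [exact Ha|apply computes_id]|exact Hm].
Qed.

Definition cPush (c : code) : code :=
  cComp c (cPair (cComp cRight cLeft) (cPair (cComp cLeft cLeft) cRight)).

Lemma J_push c a b v X : J c ⟨b, ⟨a, v⟩⟩ X -> J (cPush c) ⟨⟨a, b⟩, v⟩ X.
Proof.
  intros (m & Hm & Xm). exists m. split; [|exact Xm].
  eapply ev_comp; [|exact Hm].
  apply ev_pair; [econstructor; constructor|].
  apply ev_pair; [econstructor; constructor|constructor].
Qed.

Lemma J_drop c a b v X :
  J c ⟨a, v⟩ X -> J (cComp c (cPair cLeft (cComp cRight cRight))) ⟨a, ⟨b, v⟩⟩ X.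
Proof.
  intros (m & Hm & Xm). exists m. split; [|exact Xm].
  eapply ev_comp; [|exact Hm].
  apply ev_pair; [constructor|econstructor; constructor].
Qed.

(** The value is the same for all [z] because programs are deterministic. *)
Lemma J_inter c v (A : Type) (z0 : A) (X : A -> nat -> Prop) :
  (forall z, J c v (X z)) -> J c v (fun m => forall z, X z m).
Proof.
  intros H. destruct (H z0) as (m & Hm & _). exists m. split; [exact Hm|].
  intros z. destruct (H z) as (m' & Hm' & Xm').
  now rewrite (computes_functional _ _ _ _ Hm Hm').
Qed.

Lemma J_prim k (f : prim k) g v (u : Vector.t nat k) :
  J g v (eq (enc_vec u)) -> J (cComp (compile f) g) v (eq (eval f u)).
Proof.
  intros H. eapply J_comp; [exact H|]. intros a <-.
  exists (eval f u). split; [apply compile_correct|reflexivity].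
Qed.

Definition cIter (f g h : code) : code :=
  cComp (cPrec f (cComp g (cPair (cComp cRight cRight)
                             (cPair (cComp cLeft cRight) cLeft))))
    (cPair cId h).

Lemma J_iter f g h v n (X : nat -> nat -> Prop) :
  J f v (X 0) -> (forall m r, X m r -> J g ⟨r, ⟨m, v⟩⟩ (X (S m))) ->
  J h v (eq n) -> J (cIter f g h) v (X n).
Proof.
  intros Hf Hg (n' & Hn & <-).
  assert (G : exists r, computes (cPrec f (cComp g (cPair (cComp cRight cRight)
      (cPair (cComp cLeft cRight) cLeft)))) ⟨v, n⟩ r /\ X n r).
  { clear Hn. induction n as [|n (r & Hr & Xr)].
    - destruct Hf as (r & Hr & Xr). exists r. split; [now constructor|exact Xr].
    - destruct (Hg n r Xr) as (s & Hs & Xs). exists s. split; [|exact Xs].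
      eapply ev_precS; [exact Hr|]. eapply ev_comp; [|exact Hs].
      apply ev_pair; [econstructor; constructor|].
      apply ev_pair; [econstructor; constructor|constructor]. }
  destruct G as (r & Hr & Xr). exists r. split; [|exact Xr].
  eapply ev_comp; [apply ev_pair; [apply computes_id|exact Hn]|exact Hr].
Qed.

(** * Modal propositions *)

Definition stage : Type := nat -> Prop.

(** A proposition is given by its counter-realizers at each stage [x]; a
    realizer sends each of these into [x], which plays the role of falsity.
    This makes realizability at [x] classical. *)
Definition mprop : Type := stage -> nat -> Prop.

Definition tr (P : mprop) (x : stage) : nat -> Prop := imp (P x) x.

Definition known (P : mprop) (e : nat) : Prop := forall z, tr P z e.

Definition prod (X Y : nat -> Prop) (n : nat) : Prop :=
  exists a b, n = ⟨a, b⟩ /\ X a /\ Y b.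

(** A counter-realizer of an atom or a box turns evidence for it into an element of [x]; the
    evidence for a true equation is any number, so it has no content. For an implication or a
    universal statement it is an attack: a realizer of the premise, or an instance, paired with a
    counter-realizer of what remains. *)
Definition fEq (A : Prop) : mprop := fun x => imp (fun _ => A) x.
Definition fBot : mprop := fun _ _ => True.
Definition fImp (P Q : mprop) : mprop := fun x => prod (tr P x) (Q x).
Definition fAll (P : nat -> mprop) : mprop :=
  fun x n => exists a b, n = ⟨a, b⟩ /\ P a x b.
Definition fBox (P : mprop) : mprop := fun x => imp (known P) x.
Definition fNeg (P : mprop) : mprop := fImp P fBot.
(** The classical definitions suffice, since realizability at each stage is classical. *)
Definition fAnd (P Q : mprop) : mprop := fNeg (fImp P (fNeg Q)).
Definition fOr (P Q : mprop) : mprop := fImp (fNeg P) Q.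
Definition fEx (P : nat -> mprop) : mprop := fNeg (fAll (fun a => fNeg (P a))).

#[local] Opaque to_nat of_nat.

(** * Natural deduction rules for the connectives *)

Lemma J_tr c v P (x : stage) :
  (forall b, P x b -> J c ⟨b, v⟩ x) -> J (cLam c) v (tr P x).
Proof. apply J_lam. Qed.

Lemma J_cut f g v P (x : stage) : J f v (tr P x) -> J g v (P x) -> J (cApp f g) v x.
Proof. apply J_app. Qed.

Lemma J_prod f g v X Y : J f v X -> J g v Y -> J (cPair f g) v (prod X Y).
Proof. intros Hf Hg. eapply J_pair; [eassumption..|]. unfold prod; eauto. Qed.

Lemma J_fAll f g v P x a :
  J f v (eq a) -> J g v (P a x) -> J (cPair f g) v (fAll P x).
Proof. intros Hf Hg. eapply J_pair; [eassumption..|]. intros ? b <-. unfold fAll; eauto. Qed.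

Lemma J_true v (X : nat -> Prop) : X 0 -> J cZero v X.
Proof. apply (J_const X 0). Qed.

Lemma J_known c v P : (forall z, J c v (tr P z)) -> J c v (known P).
Proof. apply J_inter. exact (fun _ => True). Qed.

(** The input of a realizer is the list of realizers of the assumptions in force,
    latest first; [use H] fetches the one that [H] is about. *)
Ltac use H :=
  lazymatch type of H with
  | J _ _ _ => first [exact H | eapply J_weak; use H]
  | _ => first [exact (J_var _ _ _ H) | eapply J_weak; use H]
  end.

(** Counter-realizers of implications and universal formulas are pairs; these
    tactics split one and put both components into the input. *)
Tactic Notation "pop" ident(a) ident(Ha) ident(Hb) :=
  let s := fresh "s" in
  intros ? (a & s & -> & Ha & Hb); eapply J_push.
Tactic Notation "popall" ident(a) ident(Hb) :=
  let s := fresh "s" in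
  intros ? (a & s & -> & Hb); eapply J_push.

Definition cImpE (f g : code) : code :=
  cLam (cApp (cComp f cRight) (cPair (cComp g cRight) cLeft)).

Lemma J_imp_elim f g v P Q x :
  J f v (tr (fImp P Q) x) -> J g v (tr P x) -> J (cImpE f g) v (tr Q x).
Proof.
  intros Hf Hg. eapply J_tr. intros b Hb.
  eapply J_cut; [use Hf|]. apply J_prod; [use Hg|use Hb].
Qed.

Lemma J_all_elim f g v P x a :
  J f v (tr (fAll P) x) -> J g v (eq a) -> J (cImpE f g) v (tr (P a) x).
Proof.
  intros Hf Hg. eapply J_tr. intros b Hb.
  eapply J_cut; [use Hf|]. eapply J_fAll; [use Hg|use Hb].
Qed.

Definition cEqE (f c : code) : code := cApp f (cLam c).

(** As in the eliminations of [fEx] and [fBox] below, the evidence is available only while the goal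
    is falsity, that is, an element of [x]. *)
Lemma J_eq_elim f c v (A : Prop) x :
  J f v (tr (fEq A) x) -> (forall n, A -> J c ⟨n, v⟩ x) -> J (cEqE f c) v x.
Proof. intros Hf Hc. eapply J_cut; [exact Hf|]. apply J_lam. exact Hc. Qed.

Definition cEqI : code := cLam (cApp cLeft cZero).

Lemma J_eq_intro v (A : Prop) x : A -> J cEqI v (tr (fEq A) x).
Proof.
  intros HA. eapply J_tr. intros b Hb. eapply J_app; [use Hb|]. now apply J_true.
Qed.

(** The final [cZero] is the counter-realizer of [fBot], for which any number does. *)
Definition cAndI (f g : code) : code :=
  cLam (cPush (cApp (cComp cLeft cRight)
    (cPair (cComp (cComp f cRight) cRight) (cPair (cComp (cComp g cRight) cRight) cZero)))).

Lemma J_and_intro f g v P Q x :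
  J f v (tr P x) -> J g v (tr Q x) -> J (cAndI f g) v (tr (fAnd P Q) x).
Proof.
  intros Hf Hg. eapply J_tr. pop h Hh Hb.
  eapply J_cut; [use Hh|].
  apply J_prod; [use Hf|]. apply J_prod; [use Hg|now apply J_true].
Qed.

Definition cExI (f g : code) : code :=
  cLam (cPush (cApp (cComp cLeft cRight)
    (cPair (cComp (cComp f cRight) cRight) (cPair (cComp (cComp g cRight) cRight) cZero)))).

Lemma J_ex_intro f g v P x a :
  J f v (eq a) -> J g v (tr (P a) x) -> J (cExI f g) v (tr (fEx P) x).
Proof.
  intros Hf Hg. eapply J_tr. pop h Hh Hb.
  eapply J_cut; [use Hh|].
  eapply J_fAll; [use Hf|]. apply J_prod; [use Hg|now apply J_true].
Qed.

Definition cExE (f c : code) : code :=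
  cApp f (cPair (cLam (cPush (cPush c))) cZero).

Lemma J_ex_elim f c v P x :
  J f v (tr (fEx P) x) ->
  (forall a p n, tr (P a) x p -> J c ⟨n, ⟨p, ⟨a, v⟩⟩⟩ x) ->
  J (cExE f c) v x.
Proof.
  intros Hf Hc. eapply J_cut; [exact Hf|].
  apply J_prod; [|now apply J_true].
  eapply J_tr. popall a Hb. destruct Hb as (p & n & -> & Hp & _).
  eapply J_push. now apply Hc.
Qed.

Definition cBoxI (f : code) : code := cLam (cApp cLeft (cComp f cRight)).

Lemma J_box_intro f v P x : J f v (known P) -> J (cBoxI f) v (tr (fBox P) x).
Proof. intros Hf. eapply J_tr. intros k Hk. eapply J_app; [use Hk|use Hf]. Qed.

Lemma J_box_elim f c v P x :
  J f v (tr (fBox P) x) -> (forall e, known P e -> J c ⟨e, v⟩ x) ->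
  J (cApp f (cLam c)) v x.
Proof. intros Hf Hc. eapply J_cut; [exact Hf|]. apply J_lam. exact Hc. Qed.

(** * Interpretation of formulas *)

(** The outer domain has one nonexistent individual [None]; quantifiers range
    over numbers only. *)
Definition env : Type := nat -> option nat.

Definition scons {A} (a : A) (ρ : nat -> A) (n : nat) : A :=
  match n with 0 => a | S n => ρ n end.

Fixpoint sequence {k} (w : Vector.t (option nat) k) : option (Vector.t nat k) :=
  match w with
  | [] => Some []
  | a :: w =>
      match a, sequence w with
      | Some a, Some u => Some (a :: u)
      | _, _ => None
      end
  end%vector.

(** Functions are strict in [None]. Equations compare the optional values, so reflexivity holds for
    nonexistent individuals too. *)
Fixpoint teval (ρ : env) (t : term) : option nat :=
  match t with
  | Var n => ρ n
  | Fn f ts => option_map (eval f) (sequence (Vector.map (teval ρ) ts))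
  end.

Fixpoint interp (φ : form) (ρ : env) : mprop :=
  match φ with
  | Eq s t => fEq (teval ρ s = teval ρ t)
  | Bot => fBot
  | And φ ψ => fAnd (interp φ ρ) (interp ψ ρ)
  | Or φ ψ => fOr (interp φ ρ) (interp ψ ρ)
  | Imp φ ψ => fImp (interp φ ρ) (interp ψ ρ)
  | All φ => fAll (fun a => interp φ (scons (Some a) ρ))
  | Ex φ => fEx (fun a => interp φ (scons (Some a) ρ))
  | Box φ => fBox (interp φ ρ)
  end.

Lemma teval_tsubst ρ σ : forall t,
  teval ρ (tsubst σ t) = teval (fun n => teval ρ (σ n)) t.
Proof.
  fix IH 1. intros [n|k f ts]; [reflexivity|]. cbn [tsubst teval].
  do 2 f_equal. clear f. induction ts as [|t k ts IHts]; [reflexivity|].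
  cbn [Vector.map]. f_equal; [apply IH|exact IHts].
Qed.

Lemma teval_up ρ σ a :
  (fun n => teval (scons a ρ) (up σ n)) = scons a (fun n => teval ρ (σ n)).
Proof.
  apply functional_extensionality. intros [|n]; [reflexivity|].
  cbn [up scons]. now rewrite teval_tsubst.
Qed.

Lemma interp_subst φ : forall σ ρ,
  interp (subst σ φ) ρ = interp φ (fun n => teval ρ (σ n)).
Proof.
  induction φ; intros σ ρ; cbn [subst interp]; rewrite ?teval_tsubst;
    try reflexivity; rewrite ?IHφ1, ?IHφ2, ?IHφ; try reflexivity.
  - f_equal. apply functional_extensionality. intros a.
    now rewrite IHφ, teval_up.
  - f_equal. apply functional_extensionality. intros a.
    now rewrite IHφ, teval_up.
Qed.

Lemma interp_inst φ t ρ : interp (inst φ t) ρ = interp φ (scons (teval ρ t) ρ).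
Proof.
  unfold inst. rewrite interp_subst. f_equal.
  apply functional_extensionality. now intros [|n].
Qed.

Lemma interp_shift φ a ρ : interp (shift φ) (scons a ρ) = interp φ ρ.
Proof. unfold shift, rename. now rewrite interp_subst. Qed.

(** Realizers are uniform in environments and stages, so that validity is
    preserved by generalization and necessitation. *)
Definition valid (φ : form) : Prop :=
  exists c, forall ρ x v, J c v (tr (interp φ ρ) x).

Lemma valid_mp φ ψ : valid (Imp φ ψ) -> valid φ -> valid ψ.
Proof.
  intros [f Hf] [g Hg]. eexists. intros ρ x v.
  eapply J_imp_elim; [apply Hf|apply Hg].
Qed.

Lemma valid_gen φ : valid φ -> valid (All φ).
Proof.
  intros [f Hf]. eexists. intros ρ x v. eapply J_tr. popall a Hb.
  eapply J_cut; [apply Hf|use Hb].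
Qed.

Lemma valid_nec φ : valid φ -> valid (Box φ).
Proof.
  intros [f Hf]. eexists. intros ρ x v.
  eapply J_box_intro, J_known. intros z. apply Hf.
Qed.

(** * Tautologies *)

Definition lit (b : bool) (P : mprop) (x : stage) : nat -> Prop :=
  if b then tr P x else imp (tr P x) x.

Definition eq_form_dec (φ ψ : form) : {φ = ψ} + {φ <> ψ} :=
  excluded_middle_informative (φ = ψ).

Definition update (v : form -> bool) (α : form) (b : bool) (φ : form) : bool :=
  if eq_form_dec α φ then b else v φ.

Fixpoint literals (v : form -> bool) (L : list form) (ρ : env) (x : stage)
    : nat -> Prop :=
  match L with
  | nil => fun _ => True
  | cons α L => prod (lit (v α) (interp α ρ) x) (literals v L ρ x)
  end.

(** Kalmár's completeness argument: the program may depend on the valuation [v] and receives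
    realizers of the signs that [v] gives to the atoms in [L]. These assumptions are later removed
    one at a time by excluded middle. *)
Definition decides (v : form -> bool) (L : list form) (b : bool)
    (P : env -> mprop) : Prop :=
  exists c, forall ρ x w, literals v L ρ x w -> J c w (lit b (P ρ) x).

Lemma literals_In v L α : In α L -> decides v L (v α) (interp α).
Proof.
  induction L as [|β L IH]; [easy|]. intros [->|H].
  - exists cLeft. intros ρ x ? (p & w & -> & Hp & _). now apply J_var.
  - destruct (IH H) as [c Hc]. eexists. intros ρ x ? (p & w & -> & _ & Hw).
    eapply J_weak. now apply Hc.
Qed.

Lemma decides_bot v L : decides v L false (fun _ => fBot).
Proof.
  eexists. intros ρ x w _. eapply J_lam. intros p Hp.
  eapply J_cut; [use Hp|now apply J_true].
Qed.

Lemma decides_imp v L b b' P Q : decides v L b P -> decides v L b' Q ->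
  decides v L (implb b b') (fun ρ => fImp (P ρ) (Q ρ)).
Proof.
  intros [f Hf] [g Hg]. destruct b; [destruct b'|]; eexists; intros ρ x w Hw;
    specialize (Hf ρ x w Hw); specialize (Hg ρ x w Hw); cbn [lit implb] in *.
  - eapply J_tr. pop a Ha Hb.
    eapply J_cut; [use Hg|use Hb].
  - eapply J_lam. intros h Hh.
    eapply J_app; [use Hg|]. eapply J_imp_elim; [use Hh|use Hf].
  - eapply J_tr. pop a Ha Hb.
    eapply J_app; [use Hf|use Ha].
Qed.

Fixpoint props (φ : form) : list form :=
  match φ with
  | Bot => nil
  | And φ ψ | Or φ ψ | Imp φ ψ => props φ ++ props ψ
  | _ => cons φ nil
  end.

Lemma decides_eval v φ L :
  incl (props φ) L -> decides v L (prop_eval v φ) (interp φ).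
Proof.
  induction φ; cbn [props prop_eval interp]; intros H;
    try (apply literals_In, H; now left); try apply decides_bot;
    apply incl_app_inv in H as [H1 H2];
    specialize (IHφ1 H1); specialize (IHφ2 H2).
  - replace (andb _ _) with
      (implb (implb (prop_eval v φ1) (implb (prop_eval v φ2) false)) false)
      by now destruct (prop_eval v φ1), (prop_eval v φ2).
    repeat apply decides_imp; auto using decides_bot.
  - replace (orb _ _) with
      (implb (implb (prop_eval v φ1) false) (prop_eval v φ2))
      by now destruct (prop_eval v φ1), (prop_eval v φ2).
    repeat apply decides_imp; auto using decides_bot.
  - now apply decides_imp.
Qed.

Lemma literals_update v α b L ρ x w :
  ~ In α L -> literals v L ρ x w -> literals (update v α b) L ρ x w.
Proof.
  revert w. induction L as [|β L IH]; [easy|].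
  intros ? Hα (p & w & -> & Hp & Hw). exists p, w.
  split; [reflexivity|]. split.
  - unfold update. destruct (eq_form_dec α β); [|exact Hp].
    subst. destruct Hα. now left.
  - apply IH; [|exact Hw]. intros H. apply Hα. now right.
Qed.

(** Against a counter-realizer of [Q], the first branch becomes a map from realizers of [P] into
    [x]; this is the refutation of [P] that the second branch asks for. *)
Definition cEM (c d : code) : code :=
  cLam (cLet (cLam (cApp (cComp c (cPair cLeft (cComp cRight cRight))) (cComp cLeft cRight)))
    (cApp (cComp d (cPair cLeft (cComp cRight cRight))) (cComp cLeft cRight))).

Lemma J_em c d v P Q x :
  (forall p, tr P x p -> J c ⟨p, v⟩ (tr Q x)) ->
  (forall p, imp (tr P x) x p -> J d ⟨p, v⟩ (tr Q x)) ->
  J (cEM c d) v (tr Q x).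
Proof.
  intros Hc Hd. eapply J_tr. intros k Hk.
  eapply J_let with (X := imp (tr P x) x).
  - eapply J_lam. intros p Hp. eapply J_cut; [|use Hk]. eapply J_drop. now apply Hc.
  - intros p Hp. eapply J_cut; [|use Hk]. eapply J_drop. now apply Hd.
Qed.

Lemma decides_cases v α L P :
  ~ In α L -> (forall v, decides v (cons α L) true P) -> decides v L true P.
Proof.
  intros Hα H.
  destruct (H (update v α true)) as [c Hc]. destruct (H (update v α false)) as [d Hd].
  cbn [literals] in Hc, Hd. unfold update at 1 in Hc. unfold update at 1 in Hd.
  destruct (eq_form_dec α α); [|easy].
  exists (cEM c d). intros ρ x w Hw. apply J_em with (P := interp α ρ).
  - intros p Hp. apply Hc. exists p, w.
    split; [reflexivity|]. split; [exact Hp|now apply literals_update].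
  - intros p Hp. apply Hd. exists p, w.
    split; [reflexivity|]. split; [exact Hp|now apply literals_update].
Qed.

Lemma decides_elim L P : NoDup L ->
  (forall v, decides v L true P) -> exists c, forall ρ x v, J c v (tr (P ρ) x).
Proof.
  intros HL. induction HL as [|α L Hα _ IH]; intros H.
  - destruct (H (fun _ => true)) as [c Hc]. exists c. intros ρ x v. now apply Hc.
  - apply IH. intros v. now apply (decides_cases v α).
Qed.

Lemma valid_tautology φ : tautology φ -> valid φ.
Proof.
  intros H. apply (decides_elim (nodup eq_form_dec (props φ)));
    [apply NoDup_nodup|].
  intros v. rewrite <- (H v). apply decides_eval.
  intros α. now rewrite nodup_In.
Qed.

(** * Axioms of quantified modal logic *)

Lemma valid_QK φ : QK_base φ -> valid φ.
Proof.
  intros [φ' H|φ' ψ|φ'|φ' ψ|φ'|φ']; clear φ;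
    [now apply valid_tautology|eexists; intros ρ x v..]; cbn [interp Iff Neg].
  - eapply J_tr. pop a Ha Hb. destruct Hb as (b & k & -> & Hb & Hk). eapply J_push.
    eapply J_box_elim; [use Ha|]. intros e He.
    eapply J_box_elim; [use Hb|]. intros e' He'.
    eapply J_app; [use Hk|].
    eapply J_known. intros z. specialize (He z). specialize (He' z).
    eapply J_imp_elim; [use He|use He'].
  - eapply J_and_intro.
    + eapply J_tr. pop a Ha Hb. eapply J_cut; [use Ha|].
      (* A vacuous quantifier may be instantiated by any number, here [0]. *)
      eapply J_fAll with (a := 0); [now apply J_true|].
      cbn beta. rewrite interp_shift. use Hb.
    + eapply J_tr. pop a Ha Hb. destruct Hb as (n & k & -> & Hk). eapply J_push.
      rewrite interp_shift in Hk. eapply J_cut; [use Ha|use Hk].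
  - eapply J_tr. pop a Ha Hb. destruct Hb as (b & k & -> & Hb & Hk). eapply J_push.
    destruct Hk as (n & k' & -> & Hk). eapply J_push.
    assert (Hn : J cLeft ⟨n, ⟨b, ⟨a, v⟩⟩⟩ (eq n)) by now apply J_var.
    eapply J_cut; [|use Hk].
    eapply J_imp_elim.
    + eapply (J_all_elim _ _ _ (fun n =>
        fImp (interp φ' (scons (Some n) ρ)) (interp ψ (scons (Some n) ρ)))); [use Ha|use Hn].
    + eapply (J_all_elim _ _ _ (fun n => interp φ' (scons (Some n) ρ)));
        [use Hb|use Hn].
  - eapply J_and_intro; eapply J_tr; pop a Ha Hb.
    + destruct Hb as (m & k & -> & Hk). eapply J_push.
      destruct Hk as (n & k' & -> & Hk). eapply J_push.
      assert (Hm : J cLeft ⟨m, ⟨a, v⟩⟩ (eq m)) by now apply J_var.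
      assert (Hn : J cLeft ⟨n, ⟨m, ⟨a, v⟩⟩⟩ (eq n)) by now apply J_var.
      unfold rename in Hk. rewrite interp_subst in Hk.
      eapply J_cut; [use Ha|].
      eapply J_fAll; [use Hn|]. eapply J_fAll; [use Hm|].
      replace (scons (Some m) (scons (Some n) ρ)) with
        (fun i => teval (scons (Some n) (scons (Some m) ρ)) (Var (swap01 i)))
        by (apply functional_extensionality; now intros [|[|i]]).
      use Hk.
    + destruct Hb as (m & k & -> & Hk). eapply J_push.
      destruct Hk as (n & k' & -> & Hk). eapply J_push.
      assert (Hm : J cLeft ⟨m, ⟨a, v⟩⟩ (eq m)) by now apply J_var.
      assert (Hn : J cLeft ⟨n, ⟨m, ⟨a, v⟩⟩⟩ (eq n)) by now apply J_var.
      eapply J_cut; [use Ha|].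
      eapply J_fAll; [use Hn|]. eapply J_fAll; [use Hm|].
      unfold rename. cbn beta. rewrite interp_subst.
      replace (fun i => teval (scons (Some m) (scons (Some n) ρ)) (Var (swap01 i)))
        with (scons (Some n) (scons (Some m) ρ))
        by (apply functional_extensionality; now intros [|[|i]]).
      use Hk.
  (* Both sides have the same interpretation, as [fEx] is defined by the dual. *)
  - eapply J_and_intro; eapply J_tr; pop a Ha Hb; (eapply J_cut; [use Ha|use Hb]).
Qed.

Lemma valid_UI φ : UI_closed φ -> valid φ.
Proof.
  intros [φ']. eexists. intros ρ x v. cbn [interp].
  eapply J_tr. popall n Hk. destruct Hk as (a & k & -> & Ha & Hk). eapply J_push.
  (* The outer quantifier hands over the number at which to instantiate; a free variable would give
     the realizer no such input. *)
  assert (Hn : J cLeft ⟨n, v⟩ (eq n)) by now apply J_var.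
  rewrite interp_inst in Hk.
  eapply J_cut; [use Ha|]. eapply J_fAll; [use Hn|use Hk].
Qed.

Lemma valid_S4 φ : S4_axiom φ -> valid φ.
Proof.
  intros [φ'|φ']; eexists; intros ρ x v; cbn [interp];
    eapply J_tr; pop a Ha Hk; (eapply J_box_elim; [use Ha|]); intros e He.
  - eapply J_cut; [use (He x)|use Hk].
  - eapply J_app; [use Hk|]. eapply J_known. intros z.
    eapply J_box_intro. use He.
Qed.

Lemma valid_eq φ : eq_axiom φ -> valid φ.
Proof.
  intros [t|φ' s t]; eexists; intros ρ x v; cbn [interp].
  - now apply J_eq_intro.
  - eapply J_tr. pop p Hp Hk. destruct Hk as (a & k & -> & Ha & Hk). eapply J_push.
    eapply J_eq_elim; [use Hp|]. intros n E.
    (* A proposition depends on a term only through its value, even under [Box], so the realizer is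
       passed on unchanged. *)
    rewrite interp_inst in Ha, Hk. rewrite E in Hk.
    eapply J_cut; [use Ha|use Hk].
Qed.

Lemma valid_CBF φ : CBF φ -> valid φ.
Proof.
  intros [φ']. eexists. intros ρ x v. cbn [interp].
  eapply J_tr. pop a Ha Hk. destruct Hk as (n & k & -> & Hk). eapply J_push.
  assert (Hn : J cLeft ⟨n, ⟨a, v⟩⟩ (eq n)) by now apply J_var.
  eapply J_box_elim; [use Ha|]. intros e He.
  eapply J_app; [use Hk|]. eapply J_known. intros z.
  eapply J_all_elim with (P := fun n => interp φ' (scons (Some n) ρ)); [use (He z)|use Hn].
Qed.

(** * Arithmetic *)

Fixpoint ext {k} (u : Vector.t nat k) (ρ : env) : env :=
  match u with
  | [] => ρ
  | a :: u => scons (Some a) (ext u ρ)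
  end%vector.

(** The numbers supplied by the [k] quantifiers are collected into one coded vector at the head of
    the input. *)
Lemma valid_alls k : forall φ,
  (exists c, forall (u : Vector.t nat k) ρ x v,
     J c ⟨enc_vec u, v⟩ (tr (interp φ (ext u ρ)) x)) ->
  valid (alls k φ).
Proof.
  induction k as [|k IH]; intros φ [c Hc].
  - exists (cComp c (cPair cZero cId)). intros ρ x v.
    apply J_comp with (X := eq ⟨0, v⟩).
    + exists ⟨0, v⟩. split; [apply ev_pair; [constructor|apply computes_id]|reflexivity].
    + intros ? <-. exact (Hc [] ρ x v)%vector.
  - unfold alls in *. rewrite Nat.iter_succ_r. apply IH.
    exists (cLam (cPush (cApp (cComp c
      (cPair (cPair (cComp cLeft cRight) (cComp cLeft (cComp cRight cRight)))
             (cComp cRight (cComp cRight cRight)))) cLeft))).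
    intros u ρ x v. apply J_tr. popall a Hk.
    eapply J_cut; [|use Hk].
    apply J_comp with (X := eq ⟨⟨a, enc_vec u⟩, v⟩).
    + exists ⟨⟨a, enc_vec u⟩, v⟩. split; [|reflexivity].
      repeat econstructor.
    + intros ? <-. exact (Hc (a :: u)%vector ρ x v).
Qed.

Lemma sequence_vars k (u : Vector.t nat k) : forall n ρ ρ',
  (forall i, ρ' (n + i) = ext u ρ i) ->
  sequence (Vector.map (teval ρ') (vars n k)) = Some u.
Proof.
  induction u as [|a k u IH]; intros n ρ ρ' H; [reflexivity|].
  cbn [vars Vector.map sequence teval].
  rewrite <- (Nat.add_0_r n) at 1. rewrite H. cbn [ext scons].
  rewrite (IH (S n) ρ); [reflexivity|].
  intros i. rewrite Nat.add_succ_comm, H. reflexivity.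
Qed.

Lemma sequence_vars0 k (u : Vector.t nat k) ρ :
  sequence (Vector.map (teval (ext u ρ)) (vars 0 k)) = Some u.
Proof. now apply (sequence_vars k u 0 ρ). Qed.

Lemma sequence_vars1 k (u : Vector.t nat k) a ρ :
  sequence (Vector.map (teval (scons a (ext u ρ))) (vars 1 k)) = Some u.
Proof. now apply (sequence_vars k u 1 ρ). Qed.

Lemma sequence_nth k (w : Vector.t (option nat) k) u i :
  sequence w = Some u -> Vector.nth w i = Some (Vector.nth u i).
Proof.
  revert u. induction i as [k|k i IH]; intros u; rewrite (Vector.eta w);
    cbn [sequence]; destruct (Vector.hd w); try discriminate;
    destruct (sequence (Vector.tl w)) eqn:E; try discriminate;
    intros [= <-]; [reflexivity|now apply IH].
Qed.

Lemma valid_alls_eq k s t :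
  (forall (u : Vector.t nat k) ρ, teval (ext u ρ) s = teval (ext u ρ) t) ->
  valid (alls k (Eq s t)).
Proof.
  intros H. apply valid_alls. eexists. intros u ρ x v. now apply J_eq_intro.
Qed.

Lemma valid_PA φ : PA φ -> valid φ.
Proof.
  intros [| |k f|k i|k m f gs|k f g|k f g|φ']; clear φ.
  - eexists. intros ρ x v. cbn [interp Neg]. eapply J_tr. popall n Hk.
    destruct Hk as (a & k & -> & Ha & _). eapply J_push.
    (* Under a false equation any program serves, for instance [cZero]. *)
    eapply J_eq_elim with (c := cZero); [use Ha|]. intros r E. discriminate E.
  - eexists. intros ρ x v. cbn [interp]. eapply J_tr. popall n Hk.
    destruct Hk as (m & k & -> & Hk). eapply J_push.
    destruct Hk as (a & k' & -> & Ha & Hk). eapply J_push.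
    eapply J_eq_elim; [use Ha|]. intros r E. injection E as ->.
    eapply J_app; [use Hk|]. now apply J_true.
  - apply valid_alls. eexists. intros u ρ x v. cbn [interp].
    eapply J_ex_intro with (a := eval f u).
    + apply J_prim. apply J_var. reflexivity.
    + apply J_eq_intro. cbn [teval scons]. now rewrite sequence_vars1.
  - apply valid_alls_eq. intros u ρ. cbn [teval]. rewrite sequence_vars0.
    cbn [option_map eval].
    rewrite <- (sequence_nth _ _ _ i (sequence_vars0 k u ρ)).
    now rewrite (Vector.nth_map _ _ _ _ eq_refl).
  - apply valid_alls_eq. intros u ρ. cbn [teval]. rewrite sequence_vars0.
    replace (sequence _) with (Some (Vector.map (fun g => eval g u) gs));
      [reflexivity|].
    clear f. induction gs as [|g m gs IH]; [reflexivity|].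
    cbn [Vector.map sequence teval]. now rewrite sequence_vars0, <- IH.
  - apply valid_alls_eq. intros u ρ. cbn [teval tzero Vector.map sequence].
    now rewrite sequence_vars0.
  - apply valid_alls_eq. intros u ρ. rewrite (Vector.eta u).
    cbn [teval tsucc Vector.map sequence ext scons].
    now rewrite sequence_vars1.
  - eexists. intros ρ x v. cbn [interp].
    eapply J_tr. pop a Ha Hk. destruct Hk as (b & k & -> & Hb & Hk). eapply J_push.
    destruct Hk as (n & k' & -> & Hk). eapply J_push.
    assert (Hn : J cLeft ⟨n, ⟨b, ⟨a, v⟩⟩⟩ (eq n)) by now apply J_var.
    rewrite interp_inst in Ha.
    eapply J_cut; [|use Hk].
    (* Induction is realized by primitive recursion at the fixed stage [x], whatever the
       proposition, so modal formulas are covered. *)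
    eapply (J_iter _ _ _ _ _ (fun n => tr (interp φ' (scons (Some n) ρ)) x));
      [use Ha| |use Hn].
    intros m r Hr.
    assert (Hm : J cLeft ⟨m, ⟨k', ⟨n, ⟨b, ⟨a, v⟩⟩⟩⟩⟩ (eq m)) by now apply J_var.
    replace (scons (Some (S m)) ρ) with
      (fun i => teval (scons (Some m) ρ)
         match i with 0 => tsucc (Var 0) | S n => Var (S n) end)
      by (apply functional_extensionality; now intros [|i]).
    rewrite <- interp_subst.
    eapply J_imp_elim; [|use Hr].
    eapply (J_all_elim _ _ _ (fun m => fImp (interp φ' (scons (Some m) ρ))
      (interp (subst _ φ') (scons (Some m) ρ)))); [use Hb|use Hm].
Qed.


(** * Epistemic Church's Thesis *)

(** A realizer is uniform in the stage, so it may be run at the very stage of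
    the pairs sought: deriving "falsity" there means computing such a pair. *)
Lemma known_witness :
  exists g, forall (P : nat -> nat -> mprop) r n,
    known (fAll (fun n => fEx (fun m => fBox (P n m)))) r ->
    J g ⟨n, r⟩ (fun k => exists m j, k = ⟨m, j⟩ /\ known (P n m) j).
Proof.
  eexists. intros P r n Hr.
  set (z := fun k => exists m j, k = ⟨m, j⟩ /\ known (P n m) j).
  specialize (Hr z).
  assert (Hn : J cLeft ⟨n, r⟩ (eq n)) by now apply J_var.
  assert (Hr' : J cRight ⟨n, r⟩ (tr (fAll (fun n => fEx (fun m => fBox (P n m)))) z)).
  { exists r. split; [constructor|exact Hr]. }
  eapply (J_ex_elim _ _ _ (fun m => fBox (P n m))).
  - eapply (J_all_elim _ _ _ (fun n => fEx (fun m => fBox (P n m)))); [use Hr'|use Hn].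
  - intros m p s Hp.
    assert (Hm : J cLeft ⟨m, ⟨n, r⟩⟩ (eq m)) by now apply J_var.
    eapply J_box_elim; [use Hp|]. intros j Hj.
    eapply J_pair; [use Hm|use Hj|].
    intros m' j' <- Hj'. exists m, j'. now split.
Qed.

Lemma J_search f g v c n m :
  J f v (eq (enc_code c)) -> J g v (eq n) -> computes c n m ->
  J (cComp cSearch (cPair f g)) v (fun q =>
    eval pT [enc_code c; n; q]%vector = 1 /\ eval pU [q]%vector = m).
Proof.
  intros Hf Hg H. apply computes_search in H as (q & Hq & HT & HU).
  eapply J_comp with (X := eq ⟨enc_code c, n⟩).
  - eapply J_pair; [exact Hf|exact Hg|]. now intros ? ? <- <-.
  - intros ? <-. exists q. auto.
Qed.

Lemma teval_T ρ e n q a b c :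
  ρ e = Some a -> ρ n = Some b -> ρ q = Some c ->
  eval pT [a; b; c]%vector = 1 ->
  teval ρ (Fn pT [Var e; Var n; Var q]%vector) = teval ρ (tsucc tzero).
Proof.
  intros He Hn Hq H. cbn [teval Vector.map sequence].
  rewrite He, Hn, Hq. cbn [option_map]. now rewrite H.
Qed.

Lemma teval_U ρ q m a b :
  ρ q = Some a -> ρ m = Some b -> eval pU [a]%vector = b ->
  teval ρ (Fn pU [Var q]%vector) = teval ρ (Var m).
Proof.
  intros Hq Hm H. cbn [teval Vector.map sequence].
  rewrite Hq, Hm. cbn [option_map]. now rewrite H.
Qed.

Lemma valid_ECT φ : ECT φ -> valid φ.
Proof.
  intros [φ']. clear φ. destruct known_witness as [g Hg].
  eexists. intros ρ x v. cbn [interp].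
  eapply J_tr. pop a Ha Hk.
  eapply J_box_elim; [use Ha|]. intros r Hr. clear Ha.
  specialize (Hg (fun n m => interp φ' (scons (Some m) (scons (Some n) ρ))) r).
  (* The witness [e] is the number of the program sending [n] to the first component of what [g]
     finds; it is computed from [r]. *)
  set (d := closure (cComp cLeft g) r).
  assert (He : J (cComp (cLam (cComp cLeft g)) cLeft) ⟨r, ⟨s, ⟨a, v⟩⟩⟩ (eq (enc_code d))).
  { apply J_comp with (X := eq r); [now apply J_var|]. intros ? <-.
    exists (enc_code d). split; [apply computes_lam|reflexivity]. }
  eapply J_cut; [|use Hk].
  eapply J_ex_intro; [use He|].
  eapply J_box_intro, J_known. intros z.
  eapply J_tr. popall n Hs.
  assert (Hn : J cLeft ⟨n, ⟨r, ⟨s, ⟨a, v⟩⟩⟩⟩ (eq n)) by now apply J_var.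
  eapply J_cut; [|use Hs]. clear Hs.
  eapply J_let with (X := fun k => exists m j, k = ⟨m, j⟩ /\
    known (interp φ' (scons (Some m) (scons (Some n) ρ))) j /\ computes d n m).
  - assert (G : J (cPair cLeft (cComp cLeft cRight)) ⟨n, ⟨r, ⟨s, ⟨a, v⟩⟩⟩⟩ (eq ⟨n, r⟩)).
    { exists ⟨n, r⟩. split; [repeat econstructor|reflexivity]. }
    eapply J_comp; [use G|]. intros ? <-.
    destruct (Hg n Hr) as (k & Hk' & m & j & -> & Hj).
    exists ⟨m, j⟩. split; [exact Hk'|]. exists m, j.
    split; [reflexivity|]. split; [exact Hj|].
    apply computes_closure. eapply ev_comp; [exact Hk'|constructor].
  - intros ? (m & j & -> & Hj & Hm). eapply J_push.
    assert (Jm : J (cComp cLeft cRight) ⟨j, ⟨m, ⟨s0, ⟨n, ⟨r, ⟨s, ⟨a, v⟩⟩⟩⟩⟩⟩⟩ (eq m)).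
    { exists m. split; [repeat econstructor|reflexivity]. }
    eapply J_let; [eapply J_search; [use He|use Hn|exact Hm]|].
    intros q [HT HU].
    eapply J_ex_intro; [use Jm|].
    eapply J_ex_intro; [now apply J_var|].
    eapply J_and_intro; [apply J_eq_intro; now eapply teval_T|].
    eapply J_and_intro; [apply J_eq_intro; now eapply teval_U|].
    eapply J_box_intro. unfold rename. rewrite interp_subst.
    (* The renaming in [ECT] skips the new variables [q] and [e], leaving the original
       environment. *)
    replace (fun i => teval _ _) with (scons (Some m) (scons (Some n) ρ)); [use Hj|].
    apply functional_extensionality. intros [|[|i]]; [reflexivity..|].
    cbn [teval]. now rewrite Nat.add_comm.
Qed.

Theorem soundness φ :
  prv (fun φ => EA_closed φ \/ CBF φ \/ ECT φ) φ -> valid φ.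
Proof.
  induction 1 as [φ H| | |].
  - destruct H as [[[H|[H|[H|H]]]|H]|[H|H]];
      auto using valid_QK, valid_UI, valid_S4, valid_eq, valid_PA, valid_CBF, valid_ECT.
  - eauto using valid_mp.
  - now apply valid_gen.
  - now apply valid_nec.
Qed.

(** * The stage of classical truth *)

Definition empty : stage := fun _ => False.

(** Nothing can be sent into the empty set, so a realizer exists there exactly when there is no
    counter-realizer. *)
Definition holds (P : mprop) : Prop := forall k, ~ P empty k.

Lemma tr_holds P e : tr P empty e -> holds P.
Proof. intros (c & _ & H) k Hk. now destruct (H k Hk) as (m & _ & []). Qed.

Lemma holds_tr P : holds P -> exists e, tr P empty e.
Proof.
  intros H. exists (enc_code cZero), cZero. split; [reflexivity|].
  intros k Hk. destruct (H k Hk).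
Qed.

Lemma holds_eq (A : Prop) : holds (fEq A) <-> A.
Proof.
  split.
  (* If [A] fails, any program is vacuously a counter-realizer. *)
  - intros H. apply NNPP. intros HA. apply (H (enc_code cZero)).
    exists cZero. split; [reflexivity|]. intros n Hn. now destruct HA.
  - intros HA k (c & _ & H). now destruct (H 0 HA) as (m & _ & []).
Qed.

Lemma holds_imp P Q : holds (fImp P Q) <-> (holds P -> holds Q).
Proof.
  split.
  - intros H HP k Hk. destruct (holds_tr P HP) as [e He].
    apply (H ⟨e, k⟩). now exists e, k.
  - intros H ? (e & k & -> & He & Hk). exact (H (tr_holds P e He) k Hk).
Qed.

Lemma holds_bot : ~ holds fBot.
Proof. intros H. now apply (H 0). Qed.

Lemma holds_neg P : holds (fNeg P) <-> ~ holds P.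
Proof. unfold fNeg. rewrite holds_imp. pose proof holds_bot. tauto. Qed.

Lemma holds_and P Q : holds (fAnd P Q) <-> holds P /\ holds Q.
Proof. unfold fAnd. rewrite holds_neg, holds_imp, holds_neg. tauto. Qed.

Lemma holds_all P : holds (fAll P) <-> forall a, holds (P a).
Proof.
  split.
  - intros H a k Hk. apply (H ⟨a, k⟩). now exists a, k.
  - intros H ? (a & k & -> & Hk). exact (H a k Hk).
Qed.

Lemma holds_ex P : holds (fEx P) <-> exists a, holds (P a).
Proof.
  unfold fEx. rewrite holds_neg, holds_all. split.
  - intros H. apply NNPP. intros G. apply H. intros a. apply holds_neg. eauto.
  - intros [a Ha] H. now apply (holds_neg (P a)) in H.
Qed.

Lemma holds_box P : holds (fBox P) <-> exists e, known P e.
Proof.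
  split.
  - intros H. apply NNPP. intros G. apply (H (enc_code cZero)).
    exists cZero. split; [reflexivity|]. intros n Hn. destruct G. now exists n.
  - intros [e He] k (c & _ & H). now destruct (H e He) as (m & _ & []).
Qed.

(** * Failure of free instantiation and of the Barcan formula *)

(** [¬ x = y], where [x] has index [0] and [y] index [1] *)
Definition free_instance : form :=
  Imp (All (Neg (Eq (Var 0) (Var 1)))) (inst (Neg (Eq (Var 0) (Var 1))) (Var 0)).

(** A nonexistent [y] differs from every number in the range of the quantifier, yet equals
    itself. *)
Lemma free_instance_fails ρ :
  ρ 0 = None -> ~ holds (interp free_instance ρ).
Proof.
  intros Hρ. unfold free_instance. cbn [interp Neg].
  rewrite holds_imp, holds_all, interp_inst. intros H.
  refine (proj1 (holds_neg _) (H _) _).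
  - intros a. apply holds_neg. rewrite holds_eq. cbn [teval scons].
    now rewrite Hρ.
  - now rewrite holds_eq.
Qed.

(** The program with number [x] has output [0] on input [x]; here [x] is variable
    [0], hence [1] under the quantifier. *)
Definition self_zero : form :=
  Ex (And (kleene_T (Var 1) (Var 1) (Var 0)) (kleene_U (Var 0) tzero)).

Definition decision : form := Or (Box self_zero) (Box (Neg self_zero)).

Definition barcan_instance : form := Imp (All (Box decision)) (Box (All decision)).

Lemma self_zero_code c ρ :
  holds (interp self_zero (scons (Some (enc_code c)) ρ)) <->
  computes c (enc_code c) 0.
Proof.
  assert (Some_inj : forall a b : nat, Some a = Some b -> a = b) by congruence.
  unfold self_zero. cbn [interp]. rewrite holds_ex, <- T_U_computes.
  split; intros [q H]; exists q; revert H; unfold kleene_T, kleene_U;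
    cbn [interp]; rewrite holds_and, !holds_eq;
    cbn [teval Vector.map sequence scons option_map tsucc tzero]; intros [HT HU].
  - split; [exact (Some_inj _ _ HT)|exact (Some_inj _ _ HU)].
  - rewrite HT, HU. split; reflexivity.
Qed.

(** The witnessing history is built into the program as a constant; the two equations then hold at
    every stage. *)
Lemma known_self_zero ρ :
  holds (interp self_zero ρ) -> exists e, known (interp self_zero ρ) e.
Proof.
  cbn [self_zero interp]. rewrite holds_ex. intros [q H].
  unfold kleene_T, kleene_U in *. cbn [interp] in *.
  rewrite holds_and, !holds_eq in H. destruct H as [HT HU].
  enough (G : exists c, J c 0 (known (interp self_zero ρ)))
    by (destruct G as (c & e & _ & He); now exists e).
  eexists. apply J_known. intros z. eapply (J_ex_intro _ _ _ _ _ q).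
  - now apply J_const.
  - apply J_and_intro; now apply J_eq_intro.
Qed.

(** The truth of equations does not depend on the stage, so a witness claimed at any stage would be
    a genuine one. *)
Lemma known_not_self_zero ρ :
  ~ holds (interp self_zero ρ) -> exists e, known (interp (Neg self_zero) ρ) e.
Proof.
  intros H. enough (G : exists c, J c 0 (known (interp (Neg self_zero) ρ)))
    by (destruct G as (c & e & _ & He); now exists e).
  eexists. apply J_known. intros z. cbn [Neg interp].
  eapply J_tr. pop p Hp Hk.
  eapply J_ex_elim; [use Hp|]. intros q r n Hr. cbn beta in Hr.
  eapply J_cut; [use Hr|].
  apply J_prod; [|now apply J_true].
  eapply J_tr. pop a Ha Hb. destruct Hb as (b & k & -> & Hb & _). eapply J_push.
  eapply J_eq_elim; [use Ha|]. intros i HT.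
  eapply J_eq_elim with (c := cZero); [use Hb|]. intros i' HU.
  destruct H. unfold self_zero. cbn [interp]. rewrite holds_ex. exists q.
  rewrite holds_and. split; apply holds_eq; assumption.
Qed.

(** For a fixed environment the right disjunct is picked by classical reasoning outside the model;
    nothing is uniform in [ρ]. *)
Lemma known_decision ρ : exists e, known (interp decision ρ) e.
Proof.
  enough (G : exists c, J c 0 (known (interp decision ρ)))
    by (destruct G as (c & e & _ & He); now exists e).
  destruct (classic (holds (interp self_zero ρ))) as [H|H].
  - destruct (known_self_zero ρ H) as [e He].
    eexists. apply J_known. intros z. unfold decision. cbn [interp].
    eapply J_tr. pop a Ha Hk.
    eapply J_cut; [use Ha|]. apply J_prod; [|now apply J_true].
    apply J_box_intro, J_const. exact He.
  - destruct (known_not_self_zero ρ H) as [e He].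
    eexists. apply J_known. intros z. unfold decision. cbn [interp].
    eapply J_tr. pop a Ha Hk.
    eapply J_app; [use Hk|]. apply J_const. exact He.
Qed.

(** A uniform realizer would yield a total program deciding [h]; on its own number it outputs [0]
    exactly if it does not. *)
Lemma undecided ρ : ~ exists e, known (interp (All decision) ρ) e.
Proof.
  intros [e He].
  set (h n := holds (interp self_zero (scons (Some n) ρ))).
  assert (D : exists c, forall n,
    J c n (fun k => (h n -> k = 1) /\ (~ h n -> k = 0))).
  { eexists. intros n.
    (* At the stage of the correct answers for [n], reaching falsity means outputting the answer;
       [e] works there as at any stage. *)
    set (z := fun k => (h n -> k = 1) /\ (~ h n -> k = 0)).
    eapply J_cut; [exact (J_const _ e n (He z))|].
    eapply J_fAll; [now apply J_id|].
    unfold decision. cbn [interp]. apply J_prod.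
    - eapply J_tr. pop p Hp Hk.
      eapply J_box_elim; [use Hp|]. intros i Hi.
      (* A known realizer also works at the empty stage, where having one means truth. *)
      apply (J_const _ 1). split; [easy|]. intros []. exact (tr_holds _ _ (Hi empty)).
    - eapply J_lam. intros i Hi. apply (J_const _ 0). split; [|easy].
      intros H. destruct (proj1 (holds_neg _) (tr_holds _ _ (Hi empty)) H). }
  destruct D as [c Hc]. destruct (Hc (enc_code c)) as (k & Hk & H1 & H0).
  pose proof (self_zero_code c ρ) as E. fold (h (enc_code c)) in E.
  destruct (classic (h (enc_code c))) as [H|H].
  - apply E in H as H'. specialize (H1 H). subst k.
    discriminate (computes_functional _ _ _ _ Hk H').
  - apply H, E. now rewrite <- (H0 H).
Qed.

Lemma barcan_instance_fails ρ : ~ holds (interp barcan_instance ρ).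
Proof.
  unfold barcan_instance. cbn [interp].
  rewrite holds_imp, holds_all, holds_box. intros H. apply (undecided ρ), H.
  intros a. apply holds_box, known_decision.
Qed.

Theorem theorem1p2 :
  exists χ β : form,
    EA χ /\ BF β /\
    consistent_with (fun φ => EA_closed φ \/ CBF φ \/ ECT φ)
      (cons (Neg χ) (cons (Neg β) nil)).
Proof.
  exists free_instance, barcan_instance. split; [|split].
  - left. right. left. constructor.
  - constructor.
  - intros H. apply soundness in H as [c Hc].
    (* All free variables are sent to the nonexistent individual; the input [0] is a dummy. *)
    destruct (Hc (fun _ => None) empty 0) as (e & _ & He).
    apply tr_holds in He. revert He. cbn [fold_right interp Neg].
    rewrite !holds_imp. pose proof holds_bot as B.
    pose proof (free_instance_fails (fun _ => None) eq_refl).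
    pose proof (barcan_instance_fails (fun _ => None)).
    tauto.
Qed.
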